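(* Let $(M,L)$ and $(M,\tilde L)$ be two conformal Finsler manifolds with $\tilde g=e^{2\sigma(x)}g$. The curvature tensors of the associated Cartan connections $\nabla$ and $\tilde\nabla$ are related by $$\tilde{\mathbf K}(X,Y)\overline Z=\mathbf K(X,Y)\overline Z-\mathfrak U_{X,Y}\Big\{(\nabla_XB)(\rho Y,\overline Z)+B(\rho X,B(\rho Y,\overline Z))+\tfrac12B(\mathbf T(X,Y),\overline Z)\Big\}$$ for all $X,Y\in\mathfrak X(\mathcal TM)$ and every $\pi$-vector field $\overline Z$. In particular: (a) $\tilde S(\overline X,\overline Y)\overline Z=S(\overline X,\overline Y)\overline Z$. (b) $\tilde P(\overline X,\overline Y)\overline Z=P(\overline X,\overline Y)\overline Z-V(\overline X,\overline Y)\overline Z$, where $$V(\overline X,\overline Y)\overline Z=S(N\overline X,\overline Y)\overline Z-(\nabla_{\gamma\overline Y}B)(\overline X,\overline Z)-B(T(\overline Y,\overline X),\overline Z).$$ (c) $\tilde R(\overline X,\overline Y)\overline Z=R(\overline X,\overline Y)\overline Z+H(\overline X,\overline Y)\overline Z$, where $$\begin{aligned}H(\overline X,\overline Y)\overline Z=\ &S(N\overline X,N\overline Y)\overline Z-\mathfrak U_{\overline X,\overline Y}\{P(\overline X,N\overline Y)\overline Z+(\nabla_{\beta\overline X}B)(\overline Y,\overline Z)\\&-(\nabla_{\mathcal L\beta\overline X}B)(\overline Y,\overline Z)+B(\overline X,B(\overline Y,\overline Z))-B(T(N\overline X,\overline Y),\overline Z)\}.\end{aligned}$$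
   Context: $M$ is a smooth manifold of finite dimension $n$; $\mathcal T M\subset TM$ is the bundle of nonzero tangent vectors, $\pi:\mathcal TM\to M$; $\pi^{-1}(TM)\to\mathcal TM$ is the pullback of $TM$ by $\pi$; its smooth sections are the $\pi$-vector fields ($\overline X,\overline Y,\dots$). $\overline\eta(u)=(u,u)$. $\gamma:\pi^{-1}(TM)\to T(\mathcal TM)$ is the vertical lift and $\rho:T(\mathcal TM)\to\pi^{-1}(TM)$ is $\rho=(\pi_{\mathcal TM},d\pi)$; $\mathcal C:=\gamma\circ\overline\eta$. For a linear connection $\nabla$ in $\pi^{-1}(TM)$ the deflection map is $K(X)=\nabla_X\overline\eta$; $\nabla$ is regular if $T(\mathcal TM)=\ker\rho\oplus\ker K$; then $\beta:=(\rho|_{\ker K})^{-1}$. Torsion: $\mathbf T(X,Y)=\nabla_X\rho Y-\nabla_Y\rho X-\rho[X,Y]$, $Q(\overline X,\overline Y)=\mathbf T(\beta\overline X,\beta\overline Y)$, $T(\overline X,\overline Y)=\mathbf T(\gamma\overline X,\beta\overline Y)$. Curvature (note the sign): $\mathbf K(X,Y)\overline Z=-\nabla_X\nabla_Y\overline Z+\nabla_Y\nabla_X\overline Z+\nabla_{[X,Y]}\overline Z$; $R(\overline X,\overline Y)\overline Z=\mathbf K(\beta\overline X,\beta\overline Y)\overline Z$, $P(\overline X,\overline Y)\overline Z=\mathbf K(\beta\overline X,\gamma\overline Y)\overline Z$, $S(\overline X,\overline Y)\overline Z=\mathbf K(\gamma\overline X,\gamma\overline Y)\overline Z$ (for $\tilde\nabla$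 one uses $\tilde\beta$). A Finsler manifold $(M,L)$: $L:TM\to\mathbb R$, $L\ge0$, $L(0)=0$, $L$ is $C^\infty$ on $\mathcal TM$, $C^1$ on $TM$, $\mathcal C\cdot L=L$, and $g$ with components $g_{ij}=\frac12\dot\partial_i\dot\partial_jL^2$ ($\dot\partial_i=\partial/\partial y^i$) is positive definite; $g$ is a metric in $\pi^{-1}(TM)$. The Cartan connection of $(M,L)$ is the unique regular connection with $\nabla g=0$, $Q=0$, $g(T(\overline X,\overline Y),\overline Z)=g(T(\overline X,\overline Z),\overline Y)$. $\sigma$ is a smooth function on $M$. Objects with tilde are those of $(M,\tilde L)$. Put $\omega(X,\overline Y):=\tilde\nabla_X\overline Y-\nabla_X\overline Y$, $B(\overline X,\overline Y):=\omega(\beta\overline X,\overline Y)$, $N(\overline X):=B(\overline X,\overline\eta)$, $\mathcal L:=\gamma\circ N\circ\rho$. $\mathfrak U_{X,Y}\Theta(X,Y)=\Theta(X,Y)-\Theta(Y,X)$. *)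

(* Defs.v *)
From HB Require Import structures.
From mathcomp Require Import all_boot all_order all_algebra.
From mathcomp Require Import all_classical all_reals all_analysis.

Set Implicit Arguments.
Unset Strict Implicit.
Unset Printing Implicit Defensive.

Import Order.TTheory GRing.Theory Num.Theory.
Import numFieldNormedType.Exports.

Local Open Scope classical_set_scope.
Local Open Scope ring_scope.

(* Meant for open [U]: the conditions at the points of [U] are not relative
   to [U]. *)
Fixpoint Ck (R : realType) (V W : normedModType R) (k : nat) (U : set V)
    (f : V -> W) : Prop :=
  match k with
  | 0%N => forall x, U x -> {for x, continuous f}
  | k'.+1 => (forall x, U x -> differentiable f x) /\
             forall v, Ck k' U (fun x => 'd f x v)
  end.

Definition smooth (R : realType) (V W : normedModType R) (U : set V)
  (f : V -> W) : Prop := forall k, Ck k U f.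

(* Raw charts with values in R^m; the atlas describes the subset [pts] of [T],
   the union of the chart domains.  [point c] is the inverse of [coord c] and
   is meaningful only on the range of the chart. *)
Record atlas (R : realType) (m : nat) (T : Type) := Atlas {
  index : Type;
  dom : index -> set T;
  coord : index -> T -> 'rV[R]_m;
  point : index -> 'rV[R]_m -> T }.

Arguments dom {R m T} A c : rename.
Arguments coord {R m T} A c : rename.
Arguments point {R m T} A c : rename.

(* A tangent vector is the family of its components in all the charts around
   its base point, and is 0 at the indices of the other charts: see
   [tangent]. *)
Definition tvec (R : realType) (m : nat) (T : Type) (A : atlas R m T) : Type :=
  index A -> 'rV[R]_m.

Section AtlasTheory.
Variables (R : realType) (m : nat) (T : Type) (A : atlas R m T).

Definition pts : set T := \bigcup_c dom A c.

Definition rng (c : index A) : set 'rV[R]_m := coord A c @` dom A c.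

(* The value at [x] of an expression computed in a chart [c] around [x]; it is
   used only for expressions that do not depend on the chart. *)
Definition in_chart (V : zmodType) (x : T) (F : index A -> V) : V :=
  xget 0 [set r | exists2 c, dom A c x & r = F c].

(* The tangent vector at [x] with components [y] in the chart [c]. *)
Definition of_comp (x : T) (c : index A) (y : 'rV[R]_m) : tvec A := fun d =>
  if `[< dom A d x >] then 'd (coord A d \o point A c) (coord A c x) y else 0.

Definition tangent (x : T) : set (tvec A) :=
  [set v | forall c, dom A c x -> v = of_comp x c (v c)].

Definition smooth_fun (f : T -> R) : Prop :=
  forall c, smooth (rng c) (f \o point A c).

Definition vector_field (X : T -> tvec A) : Prop :=
  (forall x, pts x -> tangent x (X x)) /\
  forall c, smooth (rng c) (fun z => X (point A c z) c).

Definition dir_deriv (x : T) (w : tvec A) (f : T -> R) : R :=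
  in_chart x (fun c => 'd (f \o point A c) (coord A c x) (w c)).

Definition bracket (X Y : T -> tvec A) : T -> tvec A := fun x c =>
  if `[< dom A c x >]
  then 'd (fun z => Y (point A c z) c) (coord A c x) (X x c)
     - 'd (fun z => X (point A c z) c) (coord A c x) (Y x c)
  else 0.

Definition tangent_atlas : atlas R (m + m) (T * tvec A) :=
  @Atlas R (m + m) (T * tvec A)%type (index A)
    (fun c => [set u | dom A c u.1 /\ tangent u.1 u.2])
    (fun c u => row_mx (coord A c u.1) (u.2 c))
    (fun c z => let x := point A c (lsubmx z) in (x, of_comp x c (rsubmx z))).

Definition slit_atlas : atlas R (m + m) (T * tvec A) :=
  @Atlas R (m + m) (T * tvec A)%type (index A)
    (fun c => dom tangent_atlas c `&` [set u | u.2 <> 0])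
    (coord tangent_atlas) (point tangent_atlas).

End AtlasTheory.

Arguments pts {R m T} A.
Arguments rng {R m T} A c.
Arguments in_chart {R m T} A {V} x F.
Arguments of_comp {R m T} A x c y.
Arguments tangent {R m T} A x.
Arguments smooth_fun {R m T} A f.
Arguments vector_field {R m T} A X.
Arguments dir_deriv {R m T} A x w f.
Arguments bracket {R m T} A X Y.

(* The differential of [f] at [x]. *)
Definition tmap (R : realType) (m k : nat) (T S : Type) (A : atlas R m T)
    (B : atlas R k S) (f : T -> S) (x : T) (w : tvec A) : tvec B :=
  in_chart A x (fun c => (fun d =>
    if `[< dom B d (f x) >]
    then 'd (coord B d \o f \o point A c) (coord A c x) (w c) else 0) : tvec B).

Arguments tmap {R m k T S} A B f x w.

(* The atlas need not be maximal. *)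
Record manifold (R : realType) (n : nat) := Manifold {
  carrier :> topologicalType;
  charts : atlas R n carrier;
  manifold_hausdorff : hausdorff_space carrier;
  manifold_second_countable : @second_countable carrier;
  charts_cover : pts charts = setT;
  dom_open : forall c, open (dom charts c);
  rng_open : forall c, open (rng charts c);
  coordK : forall c x, dom charts c x -> point charts c (coord charts c x) = x;
  coord_continuous : forall c x,
    dom charts c x -> {for x, continuous (coord charts c)};
  point_continuous : forall c z,
    rng charts c z -> {for z, continuous (point charts c)};
  transition_smooth : forall c d,
    smooth (coord charts c @` (dom charts c `&` dom charts d))
           (coord charts d \o point charts c) }.

(* [SM M] is the bundle of nonzero tangent vectors. *)
Notation TM M := (tangent_atlas (charts M)).
Notation SM M := (slit_atlas (charts M)).

(* The points of [TM M] and [SM M] are pairs (base point, vector). *)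
Notation bundle_pt M := (prod (carrier M) (tvec (charts M))).

(* The fibre over [u] of the pullback of the tangent bundle is the tangent
   space at [u.1]: the element (u, v) of the pullback bundle is represented by
   [v] alone.  The two types of fields also contain non-smooth and non-tangent
   maps, which are excluded by [vector_field (SM M)] and [pi_field]; the values
   of a field outside [pts (SM M)] are irrelevant. *)
Notation field M := (bundle_pt M -> tvec (SM M)).
Notation pfield M := (bundle_pt M -> tvec (charts M)).

Definition alt (E : Type) (V : zmodType) (F : E -> E -> V) (X Y : E) : V :=
  F X Y - F Y X.

Section Finsler.
Variables (R : realType) (n : nat) (M : manifold R n).

Definition pi_field (Y : pfield M) : Prop :=
  (forall u, pts (SM M) u -> tangent (charts M) u.1 (Y u)) /\
  forall c, smooth (rng (SM M) c) (fun z => Y (point (SM M) c z) c).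

Definition eta : pfield M := fun u => u.2.

Definition rho (u : bundle_pt M) (w : tvec (SM M)) : tvec (charts M) :=
  tmap (SM M) (charts M) (fun p => p.1) u w.

(* The velocity at 0 of the curve t |-> u + t v in the fibre. *)
Definition gamma (u : bundle_pt M) (v : tvec (charts M)) : tvec (SM M) :=
  fun c => if `[< dom (SM M) c u >]
    then derive1 (fun t : R => coord (SM M) c (u.1, u.2 + t *: v)) 0 else 0.

Definition rhof (X : field M) : pfield M := fun u => rho u (X u).
Definition gammaf (X : pfield M) : field M := fun u => gamma u (X u).
Definition liouville : field M := gammaf eta.

Definition fibre_dir (i : 'I_n) : 'rV[R]_(n + n) := row_mx 0 (delta_mx 0 i).

Definition g_comp (L : bundle_pt M -> R) (c : index (SM M)) (u : bundle_pt M)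
    (i j : 'I_n) : R :=
  2^-1 * 'D_(fibre_dir i)
    ('D_(fibre_dir j) ((fun p => L p ^+ 2) \o point (SM M) c))
    (coord (SM M) c u).

Definition metric (L : bundle_pt M -> R) (u : bundle_pt M)
    (v w : tvec (charts M)) : R :=
  in_chart (SM M) u
    (fun c => \sum_i \sum_j g_comp L c u i j * v c 0 i * w c 0 j).

(* On the whole tangent bundle, C^1 is asked of L^2 and not of L: a nonnegative
   L that is positively homogeneous of degree 1 and differentiable at the zero
   section vanishes, which contradicts the positivity of g (unless n = 0 or M
   is empty). *)
Record finsler (L : bundle_pt M -> R) : Prop := Finsler {
  finsler_ge0 : forall u, pts (TM M) u -> 0 <= L u;
  finsler_zero : forall x : M, L (x, 0) = 0;
  finsler_smooth : smooth_fun (SM M) L;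
  finsler_C1 : forall c,
    Ck 1 (rng (TM M) c) ((fun u => L u ^+ 2) \o point (TM M) c);
  finsler_homogeneous : forall u, pts (SM M) u ->
    dir_deriv (SM M) u (liouville u) L = L u;
  finsler_posdef : forall u v, pts (SM M) u ->
    tangent (charts M) u.1 v -> v <> 0 -> 0 < metric L u v v }.

Definition conformal (sigma : M -> R) (L L' : bundle_pt M -> R) : Prop :=
  forall u v w, pts (SM M) u ->
    tangent (charts M) u.1 v -> tangent (charts M) u.1 w ->
    metric L' u v w = expR (2 * sigma u.1) * metric L u v w.

(* [D Z u w] is the covariant derivative at [u] of the section [Z] along the
   tangent vector [w]: a connection is given as the operator from sections to
   sections of the bundle of homomorphisms from the tangent bundle of [SM M] to
   the pullback bundle, whose smoothness is that of its components. *)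
Definition connection : Type :=
  pfield M -> forall u : bundle_pt M, tvec (SM M) -> tvec (charts M).

Record linear_connection (D : connection) : Prop := LinearConnection {
  conn_tangent : forall Z u w,
    pi_field Z -> pts (SM M) u -> tangent (SM M) u w ->
    tangent (charts M) u.1 (D Z u w);
  conn_linear : forall Z u (a : R) w w',
    pi_field Z -> pts (SM M) u -> tangent (SM M) u w -> tangent (SM M) u w' ->
    D Z u (a *: w + w') = a *: D Z u w + D Z u w';
  conn_add : forall Z Z' u w,
    pi_field Z -> pi_field Z' -> pts (SM M) u -> tangent (SM M) u w ->
    D (Z + Z') u w = D Z u w + D Z' u w;
  conn_leibniz : forall f Z u w,
    smooth_fun (SM M) f -> pi_field Z -> pts (SM M) u ->
    tangent (SM M) u w ->
    D (fun p => f p *: Z p) u w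
    = dir_deriv (SM M) u w f *: Z u + f u *: D Z u w;
  conn_smooth : forall Z c (e : 'rV[R]_(n + n)), pi_field Z ->
    smooth (rng (SM M) c) (fun z =>
      let u := point (SM M) c z in D Z u (of_comp (SM M) u c e) c) }.

Definition nab (D : connection) (X : field M) (Z : pfield M) : pfield M :=
  fun u => D Z u (X u).

Definition deflection (D : connection) (u : bundle_pt M) (w : tvec (SM M)) :
  tvec (charts M) := D eta u w.

Definition regular (D : connection) : Prop := forall u, pts (SM M) u ->
  (forall w, tangent (SM M) u w -> exists a b,
     [/\ tangent (SM M) u a /\ rho u a = 0,
         tangent (SM M) u b /\ deflection D u b = 0 & w = a + b]) /\
  (forall w, tangent (SM M) u w -> rho u w = 0 -> deflection D u w = 0 ->
     w = 0).

Definition beta (D : connection) (u : bundle_pt M) (v : tvec (charts M)) :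
    tvec (SM M) :=
  xget 0 [set w | [/\ tangent (SM M) u w, deflection D u w = 0 & rho u w = v]].

Definition betaf (D : connection) (X : pfield M) : field M :=
  fun u => beta D u (X u).

Definition torsion (D : connection) (X Y : field M) : pfield M :=
  nab D X (rhof Y) - nab D Y (rhof X) - rhof (bracket (SM M) X Y).

Definition Qtor (D : connection) (X Y : pfield M) : pfield M :=
  torsion D (betaf D X) (betaf D Y).
Definition Ttor (D : connection) (X Y : pfield M) : pfield M :=
  torsion D (gammaf X) (betaf D Y).

Definition curv (D : connection) (X Y : field M) (Z : pfield M) : pfield M :=
  - nab D X (nab D Y Z) + nab D Y (nab D X Z) + nab D (bracket (SM M) X Y) Z.

Definition Rcurv (D : connection) (X Y Z : pfield M) : pfield M :=
  curv D (betaf D X) (betaf D Y) Z.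
Definition Pcurv (D : connection) (X Y Z : pfield M) : pfield M :=
  curv D (betaf D X) (gammaf Y) Z.
Definition Scurv (D : connection) (X Y Z : pfield M) : pfield M :=
  curv D (gammaf X) (gammaf Y) Z.

Record cartan_connection (L : bundle_pt M -> R) (D : connection) : Prop :=
  CartanConnection {
  cartan_linear : linear_connection D;
  cartan_regular : regular D;
  cartan_metric : forall X Y Z u,
    vector_field (SM M) X -> pi_field Y -> pi_field Z -> pts (SM M) u ->
    dir_deriv (SM M) u (X u) (fun p => metric L p (Y p) (Z p))
    = metric L u (nab D X Y u) (Z u) + metric L u (Y u) (nab D X Z u);
  cartan_Q : forall X Y u, pi_field X -> pi_field Y -> pts (SM M) u ->
    Qtor D X Y u = 0;
  cartan_T : forall X Y Z u,
    pi_field X -> pi_field Y -> pi_field Z -> pts (SM M) u ->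
    metric L u (Ttor D X Y u) (Z u) = metric L u (Ttor D X Z u) (Y u) }.

Section Difference.
Variables D D' : connection.

Definition omega (X : field M) (Y : pfield M) : pfield M :=
  nab D' X Y - nab D X Y.

Definition Bdiff (X Y : pfield M) : pfield M := omega (betaf D X) Y.

Definition Ndiff (X : pfield M) : pfield M := Bdiff X eta.

Definition Lcal (X : field M) : field M := gammaf (Ndiff (rhof X)).

Definition nabB (X : field M) (Y Z : pfield M) : pfield M :=
  nab D X (Bdiff Y Z) - Bdiff (nab D X Y) Z - Bdiff Y (nab D X Z).

Definition Vterm (X Y Z : pfield M) : pfield M :=
  Scurv D (Ndiff X) Y Z - nabB (gammaf Y) X Z - Bdiff (Ttor D Y X) Z.

Definition Hterm (X Y Z : pfield M) : pfield M :=
  Scurv D (Ndiff X) (Ndiff Y) Z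
  - alt (fun X Y => Pcurv D X (Ndiff Y) Z + nabB (betaf D X) Y Z
                    - nabB (Lcal (betaf D X)) Y Z + Bdiff X (Bdiff Y Z)
                    - Bdiff (Ttor D (Ndiff X) Y) Z) X Y.

End Difference.

End Finsler.

(* Main.v *)
From HB Require Import structures.
Require Import Defs.
From mathcomp Require Import all_boot all_order all_algebra.
From mathcomp Require Import all_classical all_reals all_analysis.
From mathcomp Require Import perm ring lra.
Import Defs.
Import Order.TTheory GRing.Theory Num.Theory.
Import numFieldNormedType.Exports.

Set Implicit Arguments.
Unset Strict Implicit.
Unset Printing Implicit Defensive.

Local Open Scope classical_set_scope.
Local Open Scope ring_scope.

(** Let B be the difference of the two Cartan connections along horizontal
    lifts. The theorem follows from D' = D + B (rho _) by a computation, once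
    the vertical parts of the two connections have been identified.

    The vertical part of a Cartan connection D is determined by the metric.
    Metricity along gamma X and the symmetry of g (T(X, Y), Z) in Y and Z say
    that 2 g (T(X, Y), Z) is the derivative of the components of g along gamma X
    ([metric_Ttor]), as for the Christoffel symbols of the first kind. The
    factor exp (2 sigma) is constant on the fibres of the tangent bundle, so
    it cancels: conformal metrics have the same mixed torsion
    ([Ttor_conformal]), and the two connections agree along vertical fields
    ([nab_gamma]). On the other hand g is homogeneous of degree 0, so that its
    vertical derivative vanishes on the canonical section eta
    ([euler_hess3]); therefore T(X, eta) = 0, which means that the deflection
    map K inverts gamma ([deflection_gamma]).

    Hence every vector field W on the slit tangent bundle is
    beta (rho W) + gamma (K W) ([field_decomposition]), and D' - D is
    B (rho W, _) ([nab_Bdiff]); moreover beta' = beta - gamma N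
    ([beta_conformal]). Substituting the former in the curvature of D' yields
    the general formula ([curv_conformal]); the three particular cases result
    from inserting gamma X and beta' X and expanding with the bilinearity of
    the torsion and of the curvature.

    Every section against which an identity is tested, such as the difference
    of the two mixed torsions, is globally defined; what has to be proved is
    that it is smooth. For brackets this includes the independence of the
    chart, which rests on the symmetry of the second differential ([Schwarz]);
    the same symmetry makes g symmetric. For beta X it rests on Cramer's rule
    ([Ck_invmx]), as regularity only says that the matrix of the deflection
    map on vertical vectors is invertible. *)

(** * Differentials *)

Section Differentials.
Context {R : realType}.
Implicit Types V W : normedModType R.

(** The differential of f is a chosen linear map; that it only depends on the
    germ of f comes from its uniqueness. *)
Lemma near_eq_is_diff V W (f g df : V -> W) (x : V) :
  {near x, f =1 g} -> is_diff x f df -> is_diff x g df.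
Proof.
move=> fg dfx; have df' := ex_diff (is_diff_def := dfx).
have dfE := diff_val (is_diff_def := dfx).
have E : g \o shift x = cst (g x) + 'd f x +o_ 0 id.
  apply/eqaddoP => e e0.
  have /eqaddoP/(_ e e0) := diff_locally df'.
  have fgx := nbhs_singleton fg.
  have fgs : \forall h \near 0, f (h + x) = g (h + x).
    by move: fg; rewrite (near_shift 0) /=; apply: filterS => y;
      rewrite /= subr0.
  apply: filterS2 fgs => h /= fgh; by rewrite -!/(_ + _) !fctE /= fgh fgx.
have gE := diff_unique (diff_continuous df') E.
apply: DiffDef; last by rewrite gE.
by apply/diff_locallyP; rewrite gE; split=> //; exact: diff_continuous.
Qed.

Lemma continuous_sum (T : topologicalType) (V : normedModType R) (I : Type)
    (r : seq I) (f : I -> T -> V) (x : T) :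
  (forall i, {for x, continuous (f i)}) ->
  {for x, continuous (fun y => \sum_(i <- r) f i y)}.
Proof.
move=> fc; elim: r => [|i r IH].
  rewrite (_ : (fun y => _) = cst 0); first exact: cst_continuous.
  by apply/funext => y; rewrite big_nil.
rewrite (_ : (fun y => _) = f i + (fun y => \sum_(i <- r) f i y)).
  exact: continuousD.
by apply/funext => y; rewrite big_cons.
Qed.

Lemma linear_rV_expand m W (l : {linear 'rV[R]_m -> W}) (v : 'rV[R]_m) :
  l v = \sum_i v 0 i *: l (delta_mx 0 i).
Proof.
rewrite {1}[v]row_sum_delta linear_sum.
by apply: eq_bigr => i _; rewrite linearZ.
Qed.

Lemma linear_rV_continuous m W (l : {linear 'rV[R]_m -> W}) : continuous l.
Proof.
have -> : (l : _ -> _) = fun v => \sum_i v 0 i *: l (delta_mx 0 i).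
  by apply/funext => v; exact: linear_rV_expand.
move=> v; apply: continuous_sum => i; apply: cvgZr_tmp.
  exact: nbhs_filter.
exact: (differentiable_continuous (differentiable_coord v 0 i)).
Qed.

Lemma is_diff_linear m W (l : {linear 'rV[R]_m -> W}) (x : 'rV[R]_m) :
  is_diff x l l.
Proof.
apply: DiffDef; first exact/linear_differentiable/linear_rV_continuous.
by rewrite diff_lin //; exact: linear_rV_continuous.
Qed.

Lemma scaler_is_bilinear W :
  bilinear_for
    (GRing.Scale.Law.clone _ _ *:%R _) (GRing.Scale.Law.clone _ _ *:%R _)
    (@GRing.scale R W).
Proof.
split=> [u'|u] a x y /=.
- by rewrite scalerDl scalerA.
- by rewrite scalerDr !scalerA mulrC.
Qed.
HB.instance Definition _ W := bilinear_isBilinear.Build R R W W _ _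
  (@GRing.scale R W) (scaler_is_bilinear W).

Lemma is_diff_scale V W (f df : V -> R) (g dg : V -> W) (x : V) :
  is_diff x f df -> is_diff x g dg ->
  is_diff x (fun y => f y *: g y) (fun v => f x *: dg v + df v *: g x).
Proof.
move=> dfx dgx.
have sc (p : R * W) : {for p, continuous (fun q : R * W => q.1 *: q.2)}.
  by apply: cvgZ; [exact: cvg_fst|exact: cvg_snd].
have H p : is_diff p (fun q : R * W => q.1 *: q.2)
    (fun q => p.1 *: q.2 + q.1 *: p.2).
  apply: DiffDef; first exact: (@differentiable_bilin R R W W
    (@GRing.scale R W)).
  exact: (@diff_bilin R R W W (@GRing.scale R W)).
have -> : (fun y => f y *: g y) = (fun q : R * W => q.1 *: q.2) \o
  (fun y => (f y, g y)).
  by [].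
exact: is_diff_eq.
Qed.

Lemma is_diff_sum V W (I : Type) (r : seq I) (f df : I -> V -> W) (x : V) :
  (forall i, is_diff x (f i) (df i)) ->
  is_diff x (fun y => \sum_(i <- r) f i y) (fun v => \sum_(i <- r) df i v).
Proof.
move=> dfx; elim: r => [|i r IH].
  rewrite (_ : (fun y => _) = cst 0); last by apply/funext => y;
    rewrite big_nil.
  by apply: is_diff_eq; apply/funext => y; rewrite big_nil.
rewrite (_ : (fun y => _) = f i + (fun y => \sum_(i <- r) f i y)).
  by apply: is_diff_eq; apply/funext => y; rewrite big_cons.
by apply/funext => y; rewrite big_cons.
Qed.

Lemma is_diff_lin_comp V W m (l : {linear 'rV[R]_m -> W}) (f df : V -> 'rV[R]_m)
  (x : V) :
  is_diff x f df -> is_diff x (fun y => l (f y)) (fun v => l (df v)).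
Proof. by move=> dfx; have := @is_diff_comp _ _ _ _ f df l l x dfx
  (is_diff_linear _ _). Qed.

Lemma linear_expand W m (l : 'rV[R]_m -> W) : linear l ->
  forall v, l v = \sum_i v 0 i *: l (delta_mx 0 i).
Proof.
move=> ll v; pose lM := GRing.isLinear.Build _ _ _ _ l ll.
pose lL : {linear _ -> _} := HB.pack l lM.
exact: (linear_rV_expand lL v).
Qed.

Definition coordf m (i : 'I_m) (v : 'rV[R]_m) : R := v 0 i.
Lemma coordf_linear m (i : 'I_m) : linear (coordf i).
Proof. by move=> a u v; rewrite /coordf !mxE. Qed.
HB.instance Definition _ m (i : 'I_m) := GRing.isLinear.Build R 'rV[R]_m R *:%R
  (coordf i) (coordf_linear i).

(** The linear relations between the values [G z v] hold near [x], hence also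
    between their derivatives. *)
Lemma is_diff_linear_param V W m (G dG : V -> 'rV[R]_m -> W) (x a : V) :
  (\forall z \near x, linear (G z)) ->
  (forall v, is_diff x (G ^~ v) (dG ^~ v)) -> linear (dG a).
Proof.
move=> Gl dGx k u v.
have H : is_diff x (G ^~ (k *: u + v))
  (k *: (dG ^~ u : V -> W) + (dG ^~ v : V -> W)).
  apply: (@near_eq_is_diff _ _ (k *: (G ^~ u : V -> W) + (G ^~ v : V -> W))).
  by apply: filterS Gl => z Gz; rewrite Gz.
have := diff_val (is_diff_def := H).
by rewrite (diff_val (is_diff_def := dGx _)) => /(congr1 (@^~ a)).
Qed.

(** The product rule for the evaluation of a family of linear maps. Expanding
    the argument in the standard basis reduces it to the partial maps [G ^~ v],
    the form in which iterated differentials and connections are given. *)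
Lemma is_diff_apply V W m (G dG : V -> 'rV[R]_m -> W)
    (h dh : V -> 'rV[R]_m) (x : V) :
  (\forall z \near x, linear (G z)) ->
  (forall v, is_diff x (G ^~ v) (dG ^~ v)) -> is_diff x h dh ->
  is_diff x (fun z => G z (h z)) (fun a => dG a (h x) + G x (dh a)).
Proof.
move=> Gl dGx dhx.
have dhi i : is_diff x (fun z => h z 0 i) (fun a => dh a 0 i).
  exact: (@is_diff_lin_comp V _ m (coordf i)).
have S : is_diff x (fun z => \sum_i h z 0 i *: G z (delta_mx 0 i))
   (fun a => \sum_i (h x 0 i *: dG a (delta_mx 0 i) + dh a 0 i *: G x
     (delta_mx 0 i))).
  by apply: is_diff_sum => i; apply: is_diff_scale.
apply: (@near_eq_is_diff _ _ (fun z => \sum_i h z 0 i *: G z (delta_mx 0 i))).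
  by apply: filterS Gl => z Gz; rewrite -linear_expand.
apply: is_diff_eq S _; apply/funext => a.
rewrite big_split /= (linear_expand (nbhs_singleton Gl)); congr (_ + _).
by rewrite [RHS](linear_expand (is_diff_linear_param _ Gl dGx)).
Qed.

End Differentials.

(** * Maps of class C^k *)

Section CkTheory.
Context {R : realType}.
Implicit Types V W : normedModType R.

Lemma open_near (T : topologicalType) (U : set T) (x : T) (P : T -> Prop) :
  open U -> U x -> (forall y, U y -> P y) -> \forall y \near x, P y.
Proof. by move=> Uo Ux UP; apply: filterS UP _; exact: open_nbhs_nbhs. Qed.

Lemma is_diffE V W (f df : V -> W) (x v : V) : is_diff x f df ->
  'd f x v = df v.
Proof. by move=> H; rewrite (diff_val (is_diff_def := H)). Qed.

Lemma is_diff_ex V W (f df : V -> W) (x : V) : is_diff x f df ->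
  differentiable f x.
Proof. by move=> H; exact: (ex_diff (is_diff_def := H)). Qed.

Lemma CkSP k V W (U : set V) (f : V -> W) : Ck k.+1 U f ->
  (forall x, U x -> differentiable f x) /\ forall v, Ck k U (fun x => 'd f x v).
Proof. by []. Qed.

Lemma is_diff_comp_at (V V' W : normedModType R) (f df : V -> V')
  (g dg : V' -> W)
    (x : V) (y : V') : y = f x -> is_diff x f df -> is_diff y g dg ->
  is_diff x (g \o f) (dg \o df).
Proof. by move=> -> ? ?; exact: is_diff_comp. Qed.

Lemma near_eq_diffE V W (f g : V -> W) (x v : V) : {near x, f =1 g} ->
  differentiable f x -> 'd f x v = 'd g x v.
Proof. by move=> fg df; apply/esym/is_diffE/(near_eq_is_diff
  fg)/differentiableP. Qed.

Lemma Ck_ext k V W (U : set V) (f g : V -> W) : open U ->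
  (forall x, U x -> f x = g x) -> Ck k U f -> Ck k U g.
Proof.
move=> Uo; elim: k f g => [|k IH] f g fg.
  move=> fc x Ux; have : f @ x --> g x by rewrite -(fg _ Ux); exact: fc.
  apply: cvg_trans; apply: near_eq_cvg.
  by apply: (open_near Uo Ux) => y Uy; rewrite fg.
move=> /CkSP[df Cf].
have E x : U x -> is_diff x g ('d f x).
  move=> Ux; apply: (@near_eq_is_diff _ _ _ f); first exact: open_near fg.
  exact/differentiableP/df.
split=> [x Ux|v]; first exact: is_diff_ex (E x Ux).
by apply: IH (Cf v) => x Ux; rewrite (is_diffE _ (E x Ux)).
Qed.

Lemma CkS k V W (U : set V) (f : V -> W) (df : V -> V -> W) : open U ->
  (forall x, U x -> is_diff x f (df x)) ->
  (forall v, Ck k U (fun x => df x v)) -> Ck k.+1 U f.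
Proof.
move=> Uo fdf Cdf; split=> [x Ux|v]; first exact: is_diff_ex (fdf x Ux).
by apply: Ck_ext (Cdf v) => // x Ux; rewrite (is_diffE _ (fdf x Ux)).
Qed.

Lemma CkW k V W (U : set V) (f : V -> W) : Ck k.+1 U f -> Ck k U f.
Proof.
elim: k f => [|k IH] f /CkSP[df Cf]; first by move=> x Ux;
  exact/differentiable_continuous/df.
by split=> // v; exact: IH.
Qed.

Lemma Ck_cst k V W (U : set V) (w : W) : open U -> Ck k U (fun _ => w).
Proof.
move=> Uo; elim: k w => [|k IH] w; first by move=> x _; exact: cst_continuous.
by apply: (@CkS _ _ _ _ _ (fun _ _ => 0)) => // x _; exact: is_diff_cst.
Qed.

Lemma Ck_add k V W (U : set V) (f g : V -> W) : open U ->
  Ck k U f -> Ck k U g -> Ck k U (fun x => f x + g x).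
Proof.
move=> Uo; elim: k f g => [|k IH] f g.
  by move=> fc gc x Ux; apply: continuousD; [exact: fc|exact: gc].
move=> /CkSP[df Cf] /CkSP[dg Cg].
apply: (@CkS _ _ _ _ _ (fun x v => 'd f x v + 'd g x v)) => // [x Ux|v].
  by apply: is_diffD; apply/differentiableP; [exact: df|exact: dg].
exact: IH.
Qed.

Lemma Ck_scale k V W (U : set V) (f : V -> R) (g : V -> W) : open U ->
  Ck k U f -> Ck k U g -> Ck k U (fun x => f x *: g x).
Proof.
move=> Uo; elim: k f g => [|k IH] f g.
  by move=> fc gc x Ux; apply: cvgZ; [exact: fc|exact: gc].
move=> Cf Cg; have [df Cdf] := CkSP Cf; have [dg Cdg] := CkSP Cg.
apply: (@CkS _ _ _ _ _ (fun x v => f x *: 'd g x v + 'd f x v *: g x)) => //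
  [x Ux|v].
  by apply: is_diff_scale; apply/differentiableP; [exact: df|exact: dg].
apply: Ck_add => //; apply: IH => //; exact: CkW.
Qed.

Lemma Ck_opp k V W (U : set V) (f : V -> W) : open U ->
  Ck k U f -> Ck k U (fun x => - f x).
Proof.
move=> Uo Cf.
apply: (@Ck_ext _ _ _ _ (fun x => (-1 : R) *: f x)) => //.
  by move=> x _; rewrite scaleN1r.
by apply: Ck_scale => //; exact: Ck_cst.
Qed.

Lemma Ck_sub k V W (U : set V) (f g : V -> W) : open U ->
  Ck k U f -> Ck k U g -> Ck k U (fun x => f x - g x).
Proof. by move=> Uo Cf Cg; apply: Ck_add => //; exact: Ck_opp. Qed.

Lemma Ck_sum k V W (U : set V) (I : Type) (r : seq I) (f : I -> V -> W) :
  open U -> (forall i, Ck k U (f i)) -> Ck k U (fun x => \sum_(i <- r) f i x).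
Proof.
move=> Uo Cf; elim: r => [|i r IH].
  apply: (@Ck_ext _ _ _ _ (fun _ => 0)) => //; last exact: Ck_cst.
  by move=> x _; rewrite big_nil.
apply: (Ck_ext Uo _ (Ck_add Uo (Cf i) IH)) => x _; by rewrite big_cons.
Qed.

Lemma Ck_prod k V (U : set V) (I : Type) (r : seq I) (f : I -> V -> R) :
  open U -> (forall i, Ck k U (f i)) -> Ck k U (fun x => \prod_(i <- r) f i x).
Proof.
move=> Uo Cf; elim: r => [|i r IH].
  apply: (@Ck_ext k V R U (fun _ => 1)) => //; last exact: Ck_cst.
  by move=> x _; rewrite big_nil.
apply: (Ck_ext Uo _ (Ck_scale Uo (Cf i) IH)) => x _; by rewrite big_cons.
Qed.

Lemma Ck_inv k V (U : set V) (f : V -> R) : open U ->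
  (forall x, U x -> f x != 0) -> Ck k U f -> Ck k U (fun x => (f x)^-1).
Proof.
move=> Uo f0; elim: k => [|k IH].
  by move=> fc x Ux; apply: cvgV; [exact: f0|exact: fc].
move=> Cf; have [df Cdf] := CkSP Cf; have Cinv := IH (CkW Cf).
apply: (@CkS _ _ _ _ _ (fun x v => (- 1) *:
  ((f x)^-1 *: ((f x)^-1 *: 'd f x v)))) => // [x Ux|v].
  apply: DiffDef; first by apply: differentiableV; [exact: df|exact: f0].
  rewrite diffV; [|exact: df|exact: f0]; apply/funext => v /=.
  by rewrite !scalerA expr2 invfM mulN1r.
by do ![apply: Ck_scale => //]; exact: Ck_cst.
Qed.

Lemma Ck_lin_comp k V W m (U : set V) (l : {linear 'rV[R]_m -> W})
    (f : V -> 'rV[R]_m) : open U -> Ck k U f -> Ck k U (fun x => l (f x)).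
Proof.
move=> Uo; elim: k f => [|k IH] f.
  by move=> fc x Ux; apply: continuous_comp;
    [exact: fc|exact: linear_rV_continuous].
move=> /CkSP[df Cf].
apply: (@CkS _ _ _ _ _ (fun x v => l ('d f x v))) => // [x Ux|v].
  by apply: is_diff_lin_comp; apply/differentiableP; exact: df.
exact: IH.
Qed.

Lemma Ck_comp_lin k W m V (l : {linear 'rV[R]_m -> V}) (U : set V)
    (f : V -> W) : open U -> Ck k U f -> Ck k (l @^-1` U) (fun z => f (l z)).
Proof.
move=> Uo.
have lUo : open (l @^-1` U).
  by apply: open_comp => // x _; exact: linear_rV_continuous.
elim: k f => [|k IH] f.
  by move=> fc x Ux; apply: continuous_comp;
    [exact: linear_rV_continuous|exact: fc].
move=> /CkSP[df Cf].
apply: (@CkS _ _ _ _ _ (fun x v => 'd f (l x) (l v))) => // [x Ux|v].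
  by apply: is_diff_comp; [exact: is_diff_linear|apply/differentiableP;
    exact: df].
exact: (IH _ (Cf (l v))).
Qed.

Lemma Ck_linear k W m (l : {linear 'rV[R]_m -> W}) (U : set 'rV[R]_m) :
  open U -> Ck k U l.
Proof.
move=> Uo; case: k => [|k]; first by move=> x _; exact: linear_rV_continuous.
apply: (@CkS _ _ _ _ _ (fun _ v => l v)) => // [x _|v];
  first exact: is_diff_linear.
exact: Ck_cst.
Qed.

Lemma Ck_sub_set k V W (U U' : set V) (f : V -> W) : U' `<=` U ->
  Ck k U f -> Ck k U' f.
Proof.
move=> U'U; elim: k f => [|k IH] f; first by move=> fc x /U'U; exact: fc.
by move=> /CkSP[df Cf]; split=> [x /U'U|v]; [exact: df|exact: IH].
Qed.

Lemma Ck_coord k V m (U : set V) (h : V -> 'rV[R]_m) i :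
  open U -> Ck k U h -> Ck k U (fun x => h x 0 i).
Proof. by move=> Uo Ch; exact: (@Ck_lin_comp _ _ _ _ _ (coordf i)). Qed.

Lemma Ck_rV k V m (U : set V) (h : V -> 'rV[R]_m) : open U ->
  (forall i, Ck k U (fun x => h x 0 i)) -> Ck k U h.
Proof.
move=> Uo Ch; apply: (@Ck_ext _ _ _ _ (fun x => \sum_i h x 0 i *: delta_mx 0 i))
  => //.
  by move=> x _; rewrite -row_sum_delta.
by apply: Ck_sum => // i; apply: Ck_scale => //; exact: Ck_cst.
Qed.

(** The expansion in the standard basis of [is_diff_apply]. *)
Lemma Ck_apply k V W m (U : set V) (G : V -> 'rV[R]_m -> W) (h : V -> 'rV[R]_m)
  :
  open U -> (forall z, U z -> linear (G z)) ->
  (forall v, Ck k U (G ^~ v)) -> Ck k U h -> Ck k U (fun z => G z (h z)).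
Proof.
move=> Uo Gl CG Ch.
apply: (@Ck_ext _ _ _ _ (fun z => \sum_i h z 0 i *: G z (delta_mx 0 i))) => //.
  by move=> z Uz; rewrite -(linear_expand (Gl z Uz)).
by apply: Ck_sum => // i; apply: Ck_scale => //; exact: Ck_coord.
Qed.

End CkTheory.

(** * Symmetry of second differentials *)

Section Schwarz.
Context {R : realType}.
Implicit Types V W : normedModType R.

Lemma MVT0 (g dg : R -> R) (h : R) : 0 < h ->
  (forall s, 0 <= s <= h -> is_diff s g (fun t => t * dg s)) ->
  exists2 xi, 0 <= xi <= h & g h - g 0 = h * dg xi.
Proof.
move=> h0 dgs.
have D s : 0 <= s <= h -> is_derive s 1 g (dg s).
  move=> sh; have H := dgs s sh; apply: DeriveDef.
    exact/derivable1_diffP/(is_diff_ex H).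
  by rewrite deriveE ?(is_diffE _ H) ?mul1r //; exact: is_diff_ex H.
have Dh x : x \in `]0, h[%R -> is_derive x 1 g (dg x).
  by rewrite in_itv /= => /andP[x0 xh]; apply: D; rewrite (ltW x0) (ltW xh).
have gc : {within `[0, h], continuous g}.
  apply: derivable_within_continuous => x; rewrite in_itv /= => xh.
  by have [] := D x xh.
have [x xh E] := MVT h0 Dh gc.
exists x; last by rewrite E subr0 mulrC.
by move: xh; rewrite in_itv /= => /andP[/ltW -> /ltW ->].
Qed.

Lemma is_diff_line V W (f : V -> W) (x a : V) (s : R) :
  differentiable f (s *: a + x) ->
  is_diff s (fun s => f (s *: a + x)) (fun t => t *: 'd f (s *: a + x) a).
Proof.
move=> df.
have H : is_diff s (fun s : R => s *: a + x) (fun t : R => t *: a).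
  have H1 : is_diff s (fun s : R => s *: a) (fun t : R => t *: a) :=
    is_diff_scalel s a.
  apply: is_diff_eq (is_diffD H1 (is_diff_cst x s)) _.
  by apply/funext => t; rewrite /= addr0.
have H2 := differentiableP df.
apply: is_diff_eq (is_diff_comp H H2) _.
by apply/funext => t /=; rewrite linearZ.
Qed.

Lemma is_diff_line0 V W (f : V -> W) (x a : V) : differentiable f x ->
  is_diff (0 : R) (fun t => f (t *: a + x)) (fun t => t *: 'd f x a).
Proof.
move=> df; have E : x = 0 *: a + x by rewrite scale0r add0r.
have H : forall y, y = 0 *: a + x -> differentiable f y ->
    is_diff (0 : R) (fun t => f (t *: a + x)) (fun t => t *: 'd f y a).
  by move=> y -> dfy; exact: is_diff_line.
exact: H E df.
Qed.

(** The mean value theorem in the direction [a], applied to the difference of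
    [f] and of its translate by [h *: b], and then in the direction [b]. *)
Lemma second_difference V (f : V -> R) (U : set V) (x a b : V) (h : R) :
  Ck 2 U f -> 0 < h ->
  (forall s t, 0 <= s <= h -> 0 <= t <= h -> U (x + s *: a + t *: b)) ->
  exists s t, [/\ 0 <= s <= h, 0 <= t <= h &
    f (x + h *: a + h *: b) - f (x + h *: a) - (f (x + h *: b) - f x)
    = h * (h * 'd (fun y => 'd f y a) (x + s *: a + t *: b) b)].
Proof.
move=> /CkSP[df /(_ a)/CkSP[ddf _]] h0 Uh.
have h00 : 0 <= (0 : R) <= h by rewrite lexx ltW.
have hh : 0 <= h <= h by rewrite lexx ltW.
pose g s := f (s *: a + (x + h *: b)) - f (s *: a + x).
have gE s : g s = f (x + s *: a + h *: b) - f (x + s *: a).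
  by rewrite /g [s *: a + (x + _)]addrCA [s *: a + x]addrC addrA.
pose dg s := 'd f (s *: a + (x + h *: b)) a - 'd f (s *: a + x) a.
have Dg s : 0 <= s <= h -> is_diff s g (fun t => t * dg s).
  move=> sh.
  have D1 : is_diff s (fun s => f (s *: a + (x + h *: b)))
      (fun t => t *: 'd f (s *: a + (x + h *: b)) a).
    apply: is_diff_line; apply: df; rewrite [s *: a + (x + _)]addrCA addrA.
    exact: Uh.
  have D2 : is_diff s (fun s => f (s *: a + x))
    (fun t => t *: 'd f (s *: a + x) a).
    apply: is_diff_line; apply: df; have := Uh s 0 sh h00.
    by rewrite scale0r addr0 addrC.
  apply: is_diff_eq (is_diffB D1 D2) _.
  by apply/funext => t; rewrite /dg mulrBr.
have [s sh gs] := MVT0 h0 Dg.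
pose k t := 'd f (t *: b + (x + s *: a)) a.
have Dk t : 0 <= t <= h -> is_diff t k
    (fun r => r * 'd (fun y => 'd f y a) (t *: b + (x + s *: a)) b).
  move=> th; apply: (is_diff_line (f := fun y => 'd f y a)); apply: ddf.
  by rewrite addrC; exact: Uh.
have [t th kt] := MVT0 h0 Dk.
exists s, t; split => //.
have -> : x + s *: a + t *: b = t *: b + (x + s *: a) by rewrite addrC.
have kE : k h - k 0 = dg s.
  rewrite /k /dg scale0r add0r; congr ('d f _ _ - 'd f _ _).
    by rewrite addrA addrC [h *: b + x]addrC.
  by rewrite addrC.
have g0 : f (x + h *: b) - f x = g 0 by rewrite gE scale0r addr0.
by rewrite -kt kE g0 -gE gs.
Qed.

(** The left-hand side of [second_difference] is symmetric in the directions,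
    and its quotient by h^2 tends to both iterated derivatives. *)
Lemma Schwarz_real V (f : V -> R) (U : set V) (x a b : V) : open U -> U x ->
  Ck 2 U f -> 'd (fun y => 'd f y a) x b = 'd (fun y => 'd f y b) x a.
Proof.
move=> Uo Ux Cf; have [df Cdf] := CkSP Cf.
have C c d : {for x, continuous (fun y => 'd (fun y => 'd f y c) y d)}.
  by have [_ /(_ d)] := CkSP (Cdf c); apply.
apply/eqP; rewrite -subr_eq0 -normr_le0; apply/ler_addgt0Pr => e e0.
have e20 : 0 < e / 2 by rewrite divr_gt0.
have N : \forall y \near x, [/\ U y,
    `|'d (fun y => 'd f y a) x b - 'd (fun y => 'd f y a) y b| < e / 2 &
    `|'d (fun y => 'd f y b) x a - 'd (fun y => 'd f y b) y a| < e / 2].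
  have /cvgrPdist_lt/(_ _ e20) N1 := C a b.
  have /cvgrPdist_lt/(_ _ e20) N2 := C b a.
  have N3 : nbhs x U by exact: open_nbhs_nbhs.
  by apply: filterS3 N1 N2 N3 => y.
have /nbhs_normP[d /= d0 dN] := N.
(* The parallelogram with sides h a and h b is contained in the ball of radius
   d. *)
pose h := d / (`|a| + `|b| + 1).
have ab0 : 0 < `|a| + `|b| + 1 by rewrite ltr_wpDl ?addr_ge0.
have h0 : 0 < h by rewrite divr_gt0.
have B s t : 0 <= s <= h -> 0 <= t <= h ->
    ball_ Num.norm x d (x + s *: a + t *: b).
  move=> /andP[s0 sh] /andP[t0 th]; rewrite /ball_ /= -addrA opprD addNKr
    normrN.
  apply: le_lt_trans (ler_normD _ _) _; rewrite !normrZ !ger0_norm //.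
  have : s * `|a| + t * `|b| <= h * (`|a| + `|b|).
    by rewrite mulrDr lerD // ler_wpM2r.
  move=> /le_lt_trans; apply; rewrite /h -mulrA gtr_pMr // mulrC.
  by rewrite ltr_pdivrMr // mul1r ltrDl.
have [s [t [sh th E1]]] := second_difference Cf h0
  (fun s t sh th => let: And3 P _ _ := dN _ (B s t sh th) in P).
have B' s' t' : 0 <= s' <= h -> 0 <= t' <= h ->
  ball_ Num.norm x d (x + s' *: b + t' *: a).
  by move=> ? ?; rewrite addrAC; exact: B.
have [s' [t' [sh' th' E2]]] := second_difference Cf h0
  (fun s t sh th => let: And3 P _ _ := dN _ (B' s t sh th) in P).
have hn0 : h != 0 by rewrite gt_eqF.
have E : 'd (fun y => 'd f y a) (x + s *: a + t *: b) b
       = 'd (fun y => 'd f y b) (x + s' *: b + t' *: a) a.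
  apply: (mulfI hn0); apply: (mulfI hn0); rewrite -E1 -E2.
  rewrite [x + h *: b + h *: a]addrAC; ring.
have [_ L1 _] := dN _ (B _ _ sh th); have [_ _ L2] := dN _ (B' _ _ sh' th').
rewrite add0r; apply: ltW; rewrite [e]splitr.
apply: le_lt_trans (ltrD L1 L2); rewrite E.
rewrite -[X in _ <= _ + X]normrN; apply: le_trans (ler_normD _ _).
by rewrite opprB addrA subrK.
Qed.

Lemma Schwarz V m (f : V -> 'rV[R]_m) (U : set V) (x a b : V) : open U -> U x ->
  Ck 2 U f -> 'd (fun y => 'd f y a) x b = 'd (fun y => 'd f y b) x a.
Proof.
move=> Uo Ux Cf; apply/rowP => i.
have [df Cdf] := CkSP Cf.
have dE y : U y -> is_diff y (fun y => f y 0 i) (fun c => 'd f y c 0 i).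
  by move=> Uy; apply: (@is_diff_lin_comp _ _ _ _ (coordf i));
    exact/differentiableP/df.
have E c d : 'd (fun y => 'd f y c) x d 0 i = 'd
  (fun y => 'd (fun y => f y 0 i) y c) x d.
  have [ddf _] := CkSP (Cdf c).
  have H : is_diff x (fun y => 'd f y c 0 i)
    (fun d => 'd (fun y => 'd f y c) x d 0 i).
    by apply: (@is_diff_lin_comp _ _ _ _ (coordf i)); exact/differentiableP/ddf.
  rewrite -(is_diffE d H); apply/esym/is_diffE.
  apply: (@near_eq_is_diff _ _ _ (fun y => 'd f y c 0 i)).
    by apply: (open_near Uo Ux) => y Uy; rewrite (is_diffE _ (dE y Uy)).
  exact: differentiableP (is_diff_ex H).
by rewrite !E; apply: (Schwarz_real _ _ Uo Ux); exact: Ck_coord.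
Qed.

End Schwarz.

(** * Smooth atlases *)

(** The common features of the charts of a manifold and of those induced on its
    slit tangent bundle. The points carry no topology, so that openness is asked
    of the overlaps in the coordinate space. *)
Record smooth_atlas (R : realType) (m : nat) (T : Type) (A : atlas R m T) :
  Prop := SmoothAtlas {
  at_coordK : forall c x, dom A c x -> point A c (coord A c x) = x;
  at_open : forall c, open (rng A c);
  at_overlap : forall c d, open (coord A c @` (dom A c `&` dom A d));
  at_smooth : forall c d,
    smooth (coord A c @` (dom A c `&` dom A d)) (coord A d \o point A c) }.

Arguments at_open {R m T A} _ c.
Arguments at_overlap {R m T A} _ c d.
Arguments at_smooth {R m T A} _ c d.

Section AtlasTheory.
Context {R : realType} {m : nat} {T : Type} {A : atlas R m T}.
Hypothesis HA : smooth_atlas A.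
Notation tr c d := (coord A d \o point A c).
Notation ovl c d := (coord A c @` (dom A c `&` dom A d)).

Lemma smooth_diff (V W : normedModType R) (U : set V) (f : V -> W) (x : V) :
  smooth U f -> U x -> is_diff x f ('d f x).
Proof. by move=> Sf Ux; apply/differentiableP; have [df _] := Sf 1%N;
  exact: df. Qed.

Lemma point_rng c z : rng A c z -> dom A c (point A c z) /\ coord A c
  (point A c z) = z.
Proof. by move=> [x cx <-]; rewrite at_coordK. Qed.

Lemma rng_coord c x : dom A c x -> rng A c (coord A c x).
Proof. by move=> cx; exists x. Qed.

Lemma pts_dom c x : dom A c x -> pts A x.
Proof. by move=> cx; exists c. Qed.

Lemma pts_point c z : rng A c z -> pts A (point A c z).
Proof. by move=> /point_rng[cx _]; exact: pts_dom cx. Qed.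

Lemma ovlP c d z : ovl c d z <-> rng A c z /\ dom A d (point A c z).
Proof.
split=> [[x [cx dx] <-]|[/point_rng[cx cz] dx]].
  by rewrite at_coordK //; split=> //; exact: rng_coord.
by exists (point A c z).
Qed.

Lemma ovl_coord c d x : dom A c x -> dom A d x -> ovl c d (coord A c x).
Proof. by exists x. Qed.

Lemma tr_diff c d x : dom A c x -> dom A d x ->
  is_diff (coord A c x) (tr c d) ('d (tr c d) (coord A c x)).
Proof. by move=> cx dx; apply: smooth_diff (at_smooth HA c d) _; exists x. Qed.

Lemma tr_coord c d x : dom A c x -> coord A d x = tr c d (coord A c x).
Proof. by move=> cx; rewrite /= at_coordK. Qed.

Lemma point_tr c d z : ovl c d z -> point A d (tr c d z) = point A c z.
Proof. by move=> [x [cx dx] <-]; rewrite -tr_coord // !at_coordK. Qed.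

Lemma near_ovl c d x (P : _ -> Prop) : dom A c x -> dom A d x ->
  (forall z, ovl c d z -> P z) -> \forall z \near coord A c x, P z.
Proof.
by move=> cx dx; apply: open_near; [exact: at_overlap|exact: ovl_coord].
Qed.

Lemma near_rng c x (P : _ -> Prop) : dom A c x ->
  (forall z, rng A c z -> P z) -> \forall z \near coord A c x, P z.
Proof. by move=> cx; apply: open_near; [exact: at_open|exact: rng_coord]. Qed.

Lemma tr_id c x y : dom A c x -> 'd (tr c c) (coord A c x) y = y.
Proof.
move=> cx; apply: (@is_diffE _ _ _ _ id).
apply: (@near_eq_is_diff _ _ _ id).
by apply: (near_rng cx) => z /point_rng[_] /= ->.
Qed.

Lemma tr_comp c d e x y : dom A c x -> dom A d x -> dom A e x ->
  'd (tr d e) (coord A d x) ('d (tr c d) (coord A c x) y) = 'd (tr c e)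
    (coord A c x) y.
Proof.
move=> cx dx ex.
have D1 := tr_diff cx dx; have D2 := tr_diff dx ex.
have EE : coord A d x = tr c d (coord A c x) by rewrite /= at_coordK.
have D3 := is_diff_comp_at EE D1 D2.
apply/esym/(@is_diffE _ _ _ _ (('d (tr d e) (coord A d x)) \o
  ('d (tr c d) (coord A c x)))).
apply: near_eq_is_diff D3.
by apply: (near_ovl cx dx) => z [x' [cx' dx'] <-] /=; rewrite !at_coordK.
Qed.

Lemma of_compE c d x y : dom A d x ->
  of_comp A x c y d = 'd (tr c d) (coord A c x) y.
Proof. by move=> dx; rewrite /of_comp; case: asboolP. Qed.

Lemma of_comp_out c d x y : ~ dom A d x -> of_comp A x c y d = 0.
Proof. by move=> dx; rewrite /of_comp; case: asboolP. Qed.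

Lemma of_comp_id c x y : dom A c x -> of_comp A x c y c = y.
Proof. by move=> cx; rewrite of_compE // tr_id. Qed.

Lemma of_comp_lin c x (k : R) y y' :
  of_comp A x c (k *: y + y') = k *: of_comp A x c y + of_comp A x c y'.
Proof.
apply/funext => d.
rewrite -[RHS]/(k *: of_comp A x c y d + of_comp A x c y' d) /of_comp.
by case: asboolP => _; [exact: linearP|rewrite scaler0 addr0].
Qed.

(** By the cocycle rule [tr_comp], the transformation law from one chart implies
    those between all the others. *)
Lemma tangentP c x (w : tvec A) : dom A c x ->
  (forall d, dom A d x -> w d = 'd (tr c d) (coord A c x) (w c)) ->
  (forall d, ~ dom A d x -> w d = 0) -> tangent A x w.
Proof.
move=> cx wi wo d dx; apply/funext => e.
have [ex|ex] := pselect (dom A e x); last by rewrite wo // of_comp_out.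
by rewrite of_compE // (wi d) // tr_comp // wi.
Qed.

Lemma of_comp_tangent c x y : dom A c x -> tangent A x (of_comp A x c y).
Proof.
move=> cx; apply: (tangentP cx) => d dx;
  first by rewrite of_comp_id // of_compE.
by rewrite of_comp_out.
Qed.

Lemma tangent_tr c d x (w : tvec A) : tangent A x w -> dom A c x -> dom A d x ->
  w d = 'd (tr c d) (coord A c x) (w c).
Proof. by move=> wt cx dx; rewrite {1}(wt c cx) of_compE. Qed.

Lemma tangent_out c d x (w : tvec A) : tangent A x w -> dom A c x ->
  ~ dom A d x -> w d = 0.
Proof. by move=> wt cx dx; rewrite (wt c cx) of_comp_out. Qed.

Lemma tangent_eq c x (v w : tvec A) : dom A c x -> tangent A x v ->
  tangent A x w ->
  v c = w c -> v = w.
Proof. by move=> cx vt wt vw; rewrite (vt c cx) (wt c cx) vw. Qed.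

Lemma tangent_lin (a : R) x (v w : tvec A) : tangent A x v -> tangent A x w ->
  tangent A x (a *: v + w).
Proof.
move=> vt wt c cx; apply/funext => d.
have -> : (a *: v + w) c = a *: v c + w c by [].
have -> : (a *: v + w) d = a *: v d + w d by [].
have [dx|dx] := pselect (dom A d x).
  by rewrite of_compE // linearP /= -!tangent_tr.
by rewrite of_comp_out // (tangent_out vt cx) // (tangent_out wt cx) // scaler0
  addr0.
Qed.

Lemma tangent0 x : tangent A x 0.
Proof.
move=> c cx; apply/funext => d; have -> : (0 : tvec A) c = 0 by [].
by rewrite /of_comp; case: asboolP => // _; rewrite linear0.
Qed.

Lemma tangentD x (v w : tvec A) : tangent A x v -> tangent A x w ->
  tangent A x (v + w).
Proof. by move=> vt wt; rewrite -[v]scale1r; exact: tangent_lin. Qed.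

Lemma tangentZ (a : R) x (v : tvec A) : tangent A x v -> tangent A x (a *: v).
Proof. by move=> vt; rewrite -[_ *: v]addr0; apply: tangent_lin => //;
  exact: tangent0. Qed.

Lemma tangentN x (v : tvec A) : tangent A x v -> tangent A x (- v).
Proof. by move=> vt; rewrite -scaleN1r; exact: tangentZ. Qed.

Lemma tangentB x (v w : tvec A) : tangent A x v -> tangent A x w ->
  tangent A x (v - w).
Proof. by move=> vt wt; apply: tangentD => //; exact: tangentN. Qed.

Lemma in_chartE (V : zmodType) c x (F : index A -> V) : dom A c x ->
  (forall d, dom A d x -> F d = F c) -> in_chart A x F = F c.
Proof.
move=> cx FE; rewrite /in_chart; case: xgetP => [r _ [d dx ->]|/(_ (F c))H].
  exact: FE.
by case: H; exists c.
Qed.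

Lemma dir_derivE c x (w : tvec A) (f : T -> R) : dom A c x -> tangent A x w ->
  differentiable (f \o point A c) (coord A c x) ->
  dir_deriv A x w f = 'd (f \o point A c) (coord A c x) (w c).
Proof.
move=> cx wt df; apply: (in_chartE cx) => d dx.
have D1 := tr_diff dx cx; have D2 := differentiableP df.
have EE : coord A c x = tr d c (coord A d x) by rewrite /= at_coordK.
have D3 := is_diff_comp_at EE D1 D2.
rewrite (tangent_tr wt dx cx).
apply: (@is_diffE _ _ _ _ (('d (f \o point A c) (coord A c x)) \o
  ('d (tr d c) (coord A d x)))).
apply: near_eq_is_diff D3.
by apply: (near_ovl dx cx) => z [x' [cx' dx'] <-] /=; rewrite !at_coordK.
Qed.

Lemma bracketE (X Y : T -> tvec A) c x : dom A c x ->
  bracket A X Y x c = 'd (fun z => Y (point A c z) c) (coord A c x) (X x c)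
     - 'd (fun z => X (point A c z) c) (coord A c x) (Y x c).
Proof. by move=> cx; rewrite /bracket; case: asboolP. Qed.

Lemma is_diff_field (X : T -> tvec A) c x : vector_field A X -> dom A c x ->
  is_diff (coord A c x) (fun z => X (point A c z) c)
    ('d (fun z => X (point A c z) c) (coord A c x)).
Proof. by move=> [_ XS] cx; apply: smooth_diff (XS c) _; exists x. Qed.

(** The differential of the transformation law of the components of a vector
    field, X_d (tr z) = 'd tr z (X_c z). *)
Lemma field_diff_tr (X : T -> tvec A) c d x a : vector_field A X -> dom A c x ->
  dom A d x ->
  'd (fun z => X (point A d z) d) (coord A d x) ('d (tr c d) (coord A c x) a)
  = 'd (fun z => 'd (tr c d) z (X x c)) (coord A c x) a
    + 'd (tr c d) (coord A c x) ('d (fun z => X (point A c z) c) (coord A c x)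
      a).
Proof.
move=> vX cx dx.
have D1 := tr_diff cx dx; have D2 := is_diff_field vX dx.
have EE : coord A d x = tr c d (coord A c x) by rewrite /= at_coordK.
have D3 := is_diff_comp_at EE D1 D2.
have Dt v : is_diff (coord A c x) (fun z => 'd (tr c d) z v)
  ('d (fun z => 'd (tr c d) z v) (coord A c x)).
  apply/differentiableP; have [_ /(_ v)/CkSP[H _]] := CkSP (at_smooth HA c d 2).
  exact/H/ovl_coord.
have Gl : \forall z \near coord A c x,
  linear ('d (tr c d) z : 'rV[R]_m -> 'rV[R]_m).
  by near=> z; exact: linearP.
have := @is_diff_apply _ _ _ _ (fun z => 'd (tr c d) z)
  (fun a v => 'd (fun z => 'd (tr c d) z v) (coord A c x) a)
  _ _ (coord A c x) Gl Dt (is_diff_field vX cx).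
rewrite at_coordK // => D4.
rewrite -[LHS]/((('d (fun z => X (point A d z) d) (coord A d x)) \o
  ('d (tr c d) (coord A c x))) a).
rewrite -(is_diffE a D3) -(is_diffE a D4); apply: near_eq_diffE;
  last exact: is_diff_ex D3.
apply: (near_ovl cx dx) => z [x' [cx' dx'] <-] /=; rewrite !at_coordK //.
by apply: tangent_tr => //; apply: vX.1; exact: pts_dom cx'.
Unshelve. all: by end_near. Qed.

(** The second differential of the transition map enters both halves of the
    bracket, with the arguments exchanged. *)
Lemma bracket_tangent X Y x : vector_field A X -> vector_field A Y -> pts A x ->
  tangent A x (bracket A X Y x).
Proof.
move=> vX vY [c _ cx]; apply: (tangentP cx) => d dx; last first.
  by rewrite /bracket; case: asboolP.
have tX := vX.1 _ (pts_dom cx); have tY := vY.1 _ (pts_dom cx).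
rewrite !bracketE // (tangent_tr tX cx dx) (tangent_tr tY cx dx).
have E1 := field_diff_tr (X x c) vY cx dx; have E2 :=
  field_diff_tr (Y x c) vX cx dx.
apply: etrans (congr2 (fun u v => u - v) E1 E2) _.
apply: etrans _ (esym (linearB ('d (tr c d) (coord A c x)) _ _)).
have cancel (p q r s : 'rV[R]_m) : p = q -> p + r - (q + s) = r - s.
  by move=> ->; rewrite opprD addrACA subrr add0r.
apply: cancel.
exact: (@Schwarz _ _ m (tr c d) _ (coord A c x) (Y x c) (X x c)
  (at_overlap HA c d) (ovl_coord cx dx) (at_smooth HA c d 2)).
Qed.

Lemma vector_field_bracket X Y : vector_field A X -> vector_field A Y ->
  vector_field A (bracket A X Y).
Proof.
move=> vX vY; split=> [x xp|c k]; first exact: bracket_tangent.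
have Ro := at_open HA c.
have CX j := vX.2 c j; have CY j := vY.2 c j.
have half (Z W : T -> tvec A) : vector_field A Z -> vector_field A W ->
    Ck k (rng A c) (fun z => 'd (fun z => W (point A c z) c) z
      (Z (point A c z) c)).
  move=> vZ vW; apply: (@Ck_apply _ _ _ _ _ _
    (fun z => 'd (fun z => W (point A c z) c) z)) => //.
  - by move=> z _; exact: linearP.
  - by move=> v; have [_] := CkSP (vW.2 c k.+1); apply.
  - exact: vZ.2.
apply: (Ck_ext Ro _ (Ck_sub Ro (half X Y vX vY) (half Y X vY vX))).
by move=> z /point_rng[cz E]; move: (bracketE X Y cz); rewrite E => ->.
Qed.

Lemma vector_fieldD X Y : vector_field A X -> vector_field A Y ->
  vector_field A (X + Y).
Proof.
move=> [tX sX] [tY sY]; split=> [x xp|c k].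
  by apply: tangentD; [exact: tX|exact: tY].
by apply: Ck_add (sX c k) (sY c k); exact: at_open.
Qed.

Lemma vector_fieldN X : vector_field A X -> vector_field A (- X).
Proof.
move=> [tX sX]; split=> [x xp|c k]; first by apply: tangentN; exact: tX.
by apply: Ck_opp (sX c k); exact: at_open.
Qed.

Lemma vector_fieldB X Y : vector_field A X -> vector_field A Y ->
  vector_field A (X - Y).
Proof. by move=> vX vY; apply: vector_fieldD => //; exact: vector_fieldN. Qed.

Lemma bracketC X Y x : bracket A X Y x = - bracket A Y X x.
Proof.
apply/funext => c; rewrite -[RHS]/(- (bracket A Y X x c)) /bracket.
by case: asboolP => _; rewrite ?oppr0 // opprB.
Qed.

(** A bracket at a point of the atlas only involves the fields near that point,
    and the ranges of the charts are open. *)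
Lemma bracket_congr X X' Y Y' x : vector_field A X -> vector_field A Y ->
  (forall y, pts A y -> X y = X' y) -> (forall y, pts A y -> Y y = Y' y) ->
    pts A x ->
  bracket A X Y x = bracket A X' Y' x.
Proof.
move=> vX vY XX' YY' xp; apply/funext => c; rewrite /bracket;
  case: asboolP => // cx.
rewrite -(XX' x xp) -(YY' x xp).
apply: (congr2 (fun u v => u - v)).
  apply: near_eq_diffE; last exact: is_diff_ex (is_diff_field vY cx).
  by apply: (near_rng cx) => z zr; rewrite YY' //; exact: pts_point.
apply: near_eq_diffE; last exact: is_diff_ex (is_diff_field vX cx).
by apply: (near_rng cx) => z zr; rewrite XX' //; exact: pts_point.
Qed.

Lemma bracketBl X X' Y x : vector_field A X -> vector_field A X' ->
  vector_field A Y -> pts A x ->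
  bracket A (X - X') Y x = bracket A X Y x - bracket A X' Y x.
Proof.
move=> vX vX' vY xp; apply/funext => c.
rewrite -[RHS]/(bracket A X Y x c - bracket A X' Y x c) /bracket;
  case: asboolP => cx; last by rewrite subrr.
have E := is_diffE (Y x c) (is_diffB (is_diff_field vX cx)
  (is_diff_field vX' cx)).
apply: etrans (congr2 (fun u v => u - v) (linearB _ _ _) E) _.
have swap (p q r s : 'rV[R]_m) : p - q - (r - s) = p - r - (q - s).
  by rewrite !opprB addrACA [RHS]addrACA [- r - q]addrC.
exact: swap.
Qed.

End AtlasTheory.

(** * The slit tangent bundle *)

Section RowBlocks.
Context {R : realType} {m n : nat}.

Definition inlmx (a : 'rV[R]_m) : 'rV[R]_(m + n) := row_mx a 0.
Definition inrmx (b : 'rV[R]_n) : 'rV[R]_(m + n) := row_mx 0 b.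
Lemma inlmx_linear : linear inlmx.
Proof. by move=> a u v; rewrite /inlmx scale_row_mx add_row_mx scaler0 addr0.
  Qed.
Lemma inrmx_linear : linear inrmx.
Proof. by move=> a u v; rewrite /inrmx scale_row_mx add_row_mx scaler0 addr0.
  Qed.
HB.instance Definition _ := GRing.isLinear.Build R 'rV[R]_m 'rV[R]_(m + n) *:%R
  inlmx inlmx_linear.
HB.instance Definition _ := GRing.isLinear.Build R 'rV[R]_n 'rV[R]_(m + n) *:%R
  inrmx inrmx_linear.
Lemma row_mxE (a : 'rV[R]_m) (b : 'rV[R]_n) : row_mx a b = inlmx a + inrmx b.
Proof. by rewrite /inlmx /inrmx add_row_mx addr0 add0r. Qed.

Lemma rsub_inr (b : 'rV[R]_n) : rsubmx (inrmx b) = b.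
Proof. exact: row_mxKr. Qed.
Lemma lsub_inr (b : 'rV[R]_n) : lsubmx (inrmx b) = 0.
Proof. exact: row_mxKl. Qed.

Lemma Ck_row_mx k (V : normedModType R) (U : set V) (f : V -> 'rV[R]_m)
  (g : V -> 'rV[R]_n) :
  open U -> Ck k U f -> Ck k U g -> Ck k U (fun z => row_mx (f z) (g z)).
Proof.
move=> Uo Cf Cg.
apply: (@Ck_ext _ _ _ _ _ (fun z => inlmx (f z) + inrmx (g z))) => //.
  by move=> x _; rewrite row_mxE.
by apply: Ck_add => //; exact: Ck_lin_comp.
Qed.

End RowBlocks.

Section Slit.
Context {R : realType} {n : nat} {M : manifold R n}.
Notation tr c d := (coord (charts M) d \o point (charts M) c).
Notation trS c d := (coord (SM M) d \o point (SM M) c).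

Lemma charts_smooth : smooth_atlas (charts M).
Proof.
split; [exact: coordK|exact: rng_open| |exact: transition_smooth].
move=> c d; rewrite openE => z [x [cx dx] <-].
have rc : rng (charts M) c (coord (charts M) c x) by exists x.
have N1 : nbhs (coord (charts M) c x) (rng (charts M) c).
  by apply: open_nbhs_nbhs; split=> //; exact: rng_open.
have N2 : nbhs (coord (charts M) c x)
  (point (charts M) c @^-1` dom (charts M) d).
  apply: (point_continuous rc); rewrite coordK //.
  by apply: open_nbhs_nbhs; split=> //; exact: dom_open.
rewrite /interior; apply: filterS2 N1 N2 => y [x' cx' <-] /= dx'.
by exists x' => //; rewrite coordK in dx'.
Qed.
Let HM := charts_smooth.

Lemma dom_slitP c u : dom (SM M) c u <->
  [/\ dom (charts M) c u.1, tangent (charts M) u.1 u.2 & u.2 <> 0].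
Proof. by split=> [[[]]|[]]. Qed.

(** The components of a tangent vector vanish in one chart if and only if they
    vanish in all of them. *)
Lemma slit_overlapE c d : coord (SM M) c @` (dom (SM M) c `&` dom (SM M) d) =
  [set z | (coord (charts M) c @` (dom (charts M) c `&` dom (charts M) d))
    (lsubmx z)
           /\ rsubmx z != 0].
Proof.
apply/seteqP; split=> [z [u [/dom_slitP[cu ut u0] /dom_slitP[du _ _]] <-]|z
  [[x [cx dx] xE] z0]] /=.
  rewrite row_mxKl row_mxKr; split; first by exists u.1.
  apply/eqP => uc; apply: u0; rewrite (ut c cu) uc; apply/funext => e.
  by rewrite /of_comp; case: asboolP => // _; rewrite linear0.
exists (x, of_comp (charts M) x c (rsubmx z)) => /=; last first.
  by rewrite (of_comp_id HM) // xE hsubmxK.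
have tx := of_comp_tangent HM (rsubmx z) cx.
have nx : of_comp (charts M) x c (rsubmx z) <> 0.
  by move=> /(congr1 (@^~ c)); rewrite (of_comp_id HM) // => /eqP;
    rewrite (negbTE z0).
by split; do !split.
Qed.

Lemma slit_trE c d z : rng (charts M) c (lsubmx z) ->
  dom (charts M) d (point (charts M) c (lsubmx z)) ->
  trS c d z = row_mx (tr c d (lsubmx z)) ('d (tr c d) (lsubmx z) (rsubmx z)).
Proof.
move=> zr zd.
have E : of_comp (charts M) (point (charts M) c (lsubmx z)) c (rsubmx z) d
    = 'd (tr c d) (lsubmx z) (rsubmx z).
  by apply: etrans (of_compE _ _ zd) _; rewrite (point_rng HM zr).2.
exact: (congr1 (row_mx (tr c d (lsubmx z))) E).
Qed.

Lemma slit_overlap_open c d : open (coord (SM M) c @`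
  (dom (SM M) c `&` dom (SM M) d)).
Proof.
rewrite slit_overlapE; apply: openI.
  apply: (@open_comp _ _ lsubmx) => [z _|]; first exact: continuous_lsubmx.
  exact: (at_overlap HM).
apply: (@open_comp _ _ rsubmx [set y | y != 0]) => [z _|];
  first exact: continuous_rsubmx.
have -> : [set y : 'rV[R]_n | y != 0] = ~` [set 0].
  by apply/seteqP; split=> y /= /eqP.
apply/closed_openC/accessible_closed_set1/hausdorff_accessible;
  exact: norm_hausdorff.
Qed.

Arguments slit_overlap_open c d : clear implicits.

Lemma slit_tr_smooth c d : smooth (coord (SM M) c @`
  (dom (SM M) c `&` dom (SM M) d)) (trS c d).
Proof.
move=> k.
have Uo : open (coord (charts M) c @` (dom (charts M) c `&` dom (charts M) d)).
  exact: (at_overlap HM).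
have lUo : open ((lsubmx : 'rV[R]_(n + n) -> 'rV[R]_n) @^-1`
    (coord (charts M) c @` (dom (charts M) c `&` dom (charts M) d))).
  by apply: open_comp Uo => z _; exact: continuous_lsubmx.
have Ct v : Ck k ((lsubmx : 'rV[R]_(n + n) -> 'rV[R]_n) @^-1`
    (coord (charts M) c @` (dom (charts M) c `&` dom (charts M) d)))
    (fun z => 'd (tr c d) (lsubmx z) v).
  apply: (@Ck_comp_lin _ _ _ _ _ lsubmx _ (fun y => 'd (tr c d) y v)) => //.
  by have [_] := CkSP (transition_smooth (m := M) c d k.+1); apply.
have C1 := @Ck_comp_lin _ k _ _ _ lsubmx _ _ Uo
  (transition_smooth (m := M) c d k).
have Cr : Ck k ((lsubmx : 'rV[R]_(n + n) -> 'rV[R]_n) @^-1`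
    (coord (charts M) c @` (dom (charts M) c `&` dom (charts M) d)))
    (rsubmx : 'rV[R]_(n + n) -> 'rV[R]_n).
  exact: Ck_linear.
have C2 := Ck_apply lUo (fun z _ => linearP ('d (tr c d) (lsubmx z))) Ct Cr.
have H := Ck_row_mx lUo (C1 n) C2.
have sub : coord (SM M) c @` (dom (SM M) c `&` dom (SM M) d) `<=`
    (lsubmx : 'rV[R]_(n + n) -> 'rV[R]_n) @^-1`
    (coord (charts M) c @` (dom (charts M) c `&` dom (charts M) d)).
  by rewrite slit_overlapE => z [].
apply: (Ck_ext (slit_overlap_open c d) _ (Ck_sub_set sub H)).
move=> z; rewrite slit_overlapE => -[zo _]; have [zr zd] :=
  (ovlP HM c d _).1 zo.
exact: esym (slit_trE zr zd).
Qed.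

Lemma slit_smooth : smooth_atlas (SM M).
Proof.
have Oo := slit_overlap_open.
split=> //.
- move=> c [x v] /dom_slitP[/= cx vt _]; rewrite row_mxKl row_mxKr coordK //.
  by rewrite -(vt c cx).
- by move=> c; have := Oo c c; rewrite setIid.
- exact: slit_tr_smooth.
Qed.
End Slit.

Section Pullback.
Context {R : realType} {n : nat} {M : manifold R n}.
Notation tr c d := (coord (charts M) d \o point (charts M) c).
Notation trS c d := (coord (SM M) d \o point (SM M) c).
Implicit Types (u : bundle_pt M) (v : tvec (charts M)) (w : tvec (SM M)).
Let HM := @charts_smooth R n M.
Let HS := @slit_smooth R n M.

Lemma dom_base c u : dom (SM M) c u -> dom (charts M) c u.1.
Proof. by move=> [[]]. Qed.

Lemma dom_fibre c u : dom (SM M) c u -> tangent (charts M) u.1 u.2.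
Proof. by move=> [[]]. Qed.

(** The transition maps of the slit bundle cover those of the base. *)
Lemma slit_tr_diff_base c d u (a : 'rV[R]_(n + n)) : dom (SM M) c u ->
  dom (SM M) d u ->
  lsubmx ('d (trS c d) (coord (SM M) c u) a)
  = 'd (tr c d) (coord (charts M) c u.1) (lsubmx a).
Proof.
move=> cu du.
have D1 := is_diff_lin_comp lsubmx (tr_diff HS cu du).
have Dl := is_diff_linear lsubmx (coord (SM M) c u).
have E : coord (charts M) c u.1 = lsubmx (coord (SM M) c u) by rewrite /=
  row_mxKl.
have D2 := is_diff_comp_at E Dl (tr_diff HM (dom_base cu) (dom_base du)).
rewrite -[LHS](is_diffE a D1) -[RHS](is_diffE a D2).
apply: near_eq_diffE; last exact: is_diff_ex D1.
apply: (near_rng HS cu) => z _ /=.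
by rewrite row_mxKl.
Qed.

(** The transition maps of the slit bundle are linear on the fibres. *)
Lemma slit_tr_diff_fibre c d u (a : 'rV[R]_n) : dom (SM M) c u ->
  dom (SM M) d u ->
  'd (trS c d) (coord (SM M) c u) (row_mx 0 a)
  = row_mx 0 ('d (tr c d) (coord (charts M) c u.1) a).
Proof.
move=> cu du; set z0 := coord (SM M) c u; set x := coord (charts M) c u.1.
have bc := dom_base cu; have bd := dom_base du.
have E : x = lsubmx z0 by rewrite /= row_mxKl.
have Dl := is_diff_linear lsubmx z0.
have Dr := is_diff_linear rsubmx z0.
have D1 := is_diff_comp_at E Dl (tr_diff HM bc bd).
have Dt b : is_diff z0 (fun z => 'd (tr c d) (lsubmx z) b)
    (fun a => 'd (fun z => 'd (tr c d) z b) x (lsubmx a)).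
  have [_ /(_ b)/CkSP[H _]] := CkSP (at_smooth HM c d 2%N).
  exact: is_diff_comp_at E Dl (differentiableP (H x (ovl_coord bc bd))).
have Gl : \forall z \near z0, linear
  ('d (tr c d) (lsubmx z) : 'rV[R]_n -> 'rV[R]_n).
  by near=> z; exact: linearP.
have D2 := @is_diff_apply _ _ _ _ (fun z => 'd (tr c d) (lsubmx z))
  (fun a b => 'd (fun z => 'd (tr c d) z b) x (lsubmx a)) _ _ z0 Gl Dt Dr.
have D3 := is_diffD (is_diff_lin_comp inlmx D1) (is_diff_lin_comp inrmx D2).
have D4 : is_diff z0 (trS c d) (fun a => inlmx ('d (tr c d) x (lsubmx a))
    + inrmx ('d (fun z => 'd (tr c d) z (rsubmx z0)) x (lsubmx a)
             + 'd (tr c d) (lsubmx z0) (rsubmx a))).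
  apply: near_eq_is_diff D3.
  apply: (near_ovl HS cu du) => z; rewrite slit_overlapE => -[zo _].
  have [zr zd] := (ovlP HM c d _).1 zo.
  by rewrite slit_trE // row_mxE.
apply: etrans (is_diffE (row_mx 0 a) D4) _.
have key (p q r r' : 'rV[R]_n) : p = 0 -> q = 0 -> r = r' ->
    inlmx p + inrmx (q + r) = row_mx 0 r' :> 'rV[R]_(n + n).
  by move=> -> -> ->; rewrite linear0 !add0r.
have l0 : lsubmx (row_mx 0 a : 'rV[R]_(n + n)) = 0 by rewrite row_mxKl.
apply: key.
- exact: etrans (congr1 ('d (tr c d) x) l0) (linear0 _).
- exact: etrans (congr1 ('d (fun z => 'd (tr c d) z (rsubmx z0)) x) l0)
  (linear0 _).
- exact: (congr2 (fun y b => 'd (tr c d) y b) (esym E) (row_mxKr _ _)).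
Unshelve. all: by end_near. Qed.

Lemma rhoE c u w : dom (SM M) c u -> tangent (SM M) u w ->
  rho u w = of_comp (charts M) u.1 c (lsubmx (w c)).
Proof.
move=> cu wt.
have F d : dom (SM M) d u -> (fun e => if `[< dom (charts M) e u.1 >]
    then 'd (coord (charts M) e \o (fun p => p.1) \o point (SM M) d)
      (coord (SM M) d u) (w d) else 0)
    = of_comp (charts M) u.1 d (lsubmx (w d)).
  move=> du; apply/funext => e; rewrite /of_comp; case: asboolP => // eu.
  have E : coord (charts M) d u.1 = lsubmx (coord (SM M) d u) by rewrite /=
    row_mxKl.
  have Dl := is_diff_linear lsubmx (coord (SM M) d u).
  have D2 := is_diff_comp_at E Dl (tr_diff HM (dom_base du) eu).
  exact: is_diffE (w d) D2.
rewrite /rho /tmap (in_chartE cu); first exact: F.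
move=> d du; rewrite F // [RHS]F //.
apply: (tangent_eq (dom_base cu)); try exact:
  (of_comp_tangent HM _ (dom_base _)).
rewrite (of_comp_id HM) ?of_compE; try exact: dom_base.
by rewrite -slit_tr_diff_base // -(tangent_tr wt).
Qed.

Lemma rho_tangent u w : pts (SM M) u -> tangent (SM M) u w ->
  tangent (charts M) u.1 (rho u w).
Proof.
move=> [c _ cu] wt; rewrite (rhoE cu wt);
  exact: (of_comp_tangent HM _ (dom_base cu)).
Qed.

Lemma rho_comp c u w : dom (SM M) c u -> tangent (SM M) u w ->
  rho u w c = lsubmx (w c).
Proof. by move=> cu wt; rewrite (rhoE cu wt) (of_comp_id HM) //;
  exact: dom_base. Qed.

Lemma gamma_comp c u v : dom (SM M) c u -> gamma u v c = row_mx 0 (v c).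
Proof.
move=> cu; rewrite /gamma; case: asboolP => // _.
have -> : (fun t : R => coord (SM M) c (u.1, u.2 + t *: v))
   = (fun t : R => t *: row_mx 0 (v c) + coord (SM M) c u).
  apply/funext => t /=; rewrite scale_row_mx add_row_mx scaler0 add0r addrC.
  by [].
have H : is_diff (0 : R) (fun t : R => t *: row_mx 0 (v c) + coord (SM M) c u)
    (fun t : R => t *: row_mx 0 (v c)).
  have H1 : is_diff (0 : R) (fun s : R => s *: row_mx 0 (v c) : 'rV[R]_(n + n))
    (fun t : R => t *: row_mx 0 (v c)) := is_diff_scalel 0 (row_mx 0 (v c)).
  apply: is_diff_eq (is_diffD H1 (is_diff_cst (coord (SM M) c u) 0)) _.
  by apply/funext => t; rewrite /= addr0.
by rewrite derive1E' ?(is_diffE _ H) ?scale1r //; exact: is_diff_ex H.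
Qed.

Lemma gamma_tangent u v : pts (SM M) u -> tangent (charts M) u.1 v ->
  tangent (SM M) u (gamma u v).
Proof.
move=> [c _ cu] vt; apply: (tangentP HS cu) => d du; last by rewrite /gamma;
  case: asboolP.
rewrite !gamma_comp // slit_tr_diff_fibre //; congr (row_mx 0 _).
by apply: tangent_tr => //; exact: dom_base.
Qed.

Lemma rho_lin (a : R) u w w' : pts (SM M) u -> tangent (SM M) u w ->
  tangent (SM M) u w' ->
  rho u (a *: w + w') = a *: rho u w + rho u w'.
Proof.
move=> up wt wt'; have := up => -[c _ cu].
have t1 := rho_tangent up wt; have t2 := rho_tangent up wt'.
have wt2 := tangent_lin a wt wt'.
apply: (tangent_eq (dom_base cu)) => //; first exact: rho_tangent.
  exact: tangent_lin.
rewrite (rho_comp cu) // -[RHS]/(a *: rho u w c + rho u w' c) !(rho_comp cu) //.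
by rewrite -[(_ + _) c]/(a *: w c + w' c) linearP.
Qed.

Lemma rho_gamma u v : pts (SM M) u -> tangent (charts M) u.1 v ->
  rho u (gamma u v) = 0.
Proof.
move=> up vt; have := up => -[c _ cu].
have gt := gamma_tangent up vt.
apply: (tangent_eq (dom_base cu)); [exact: rho_tangent|exact: tangent0|].
by rewrite (rho_comp cu) // gamma_comp // row_mxKl.
Qed.

End Pullback.

(** * The Finsler metric in a chart *)

Section SecondDifferential.
Context {R : realType} {N : nat}.
Implicit Types (F : 'rV[R]_N -> R) (U : set 'rV[R]_N).

(** The second differential of F at z; [a] is the direction of the outer
    derivative. *)
Definition D2 F (z a b : 'rV[R]_N) : R := 'd (fun y => 'd F y b) z a.

Lemma D2_smooth F U a b : smooth U F -> smooth U (fun z => D2 F z a b).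
Proof.
move=> SF k; have [_ /(_ b)/CkSP[_ /(_ a)]] := CkSP (SF k.+2).
exact.
Qed.

Lemma diff_smooth F U a : smooth U F -> smooth U (fun z => 'd F z a).
Proof. by move=> SF k; have [_ /(_ a)] := CkSP (SF k.+1). Qed.

Lemma D2_sym F U z a b : open U -> U z -> smooth U F -> D2 F z a b = D2 F z b a.
Proof. by move=> Uo Uz SF; exact: Schwarz_real Uo Uz (SF 2%N). Qed.

Lemma near_linear_diff F (z : 'rV[R]_N) : \forall y \near z,
  linear ('d F y : 'rV[R]_N -> R).
Proof. by near=> y; exact: linearP. Unshelve. all: by end_near. Qed.

Lemma D2_linr F U z a : open U -> U z -> smooth U F -> linear (D2 F z a).
Proof.
move=> Uo Uz SF.
apply: (is_diff_linear_param (G := fun y => 'd F y)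
  (dG := fun a b => 'd (fun y => 'd F y b) z a) a (near_linear_diff F z)) => v.
by apply: smooth_diff Uz; exact: diff_smooth.
Qed.

Lemma is_diff_D1 F U (h dh : 'rV[R]_N -> 'rV[R]_N) (z : 'rV[R]_N) : open U ->
  U z -> smooth U F ->
  is_diff z h dh ->
  is_diff z (fun y => 'd F y (h y)) (fun a => D2 F z a (h z) + 'd F z (dh a)).
Proof.
move=> Uo Uz SF Dh.
apply: (is_diff_apply (G := fun y => 'd F y)
  (dG := fun a b => 'd (fun y => 'd F y b) z a) (near_linear_diff F z)) => // v.
by apply: smooth_diff Uz; exact: diff_smooth.
Qed.

Lemma is_diff_D2 F U (h dh k dk : 'rV[R]_N -> 'rV[R]_N) (z : 'rV[R]_N) : open U
  -> U z -> smooth U F ->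
  is_diff z h dh -> is_diff z k dk ->
  is_diff z (fun y => D2 F y (h y) (k y))
    (fun a => 'd (fun y => D2 F y (h z) (k z)) z a
              + D2 F z (dh a) (k z) + D2 F z (h z) (dk a)).
Proof.
move=> Uo Uz SF Dh Dk.
have Gl (b : 'rV[R]_N) : \forall y \near z, linear (fun c => D2 F y c b).
  by near=> y; exact: linearP.
have Dab a b : is_diff z (fun y => D2 F y a b) ('d (fun y => D2 F y a b) z).
  by apply: smooth_diff Uz; exact: D2_smooth.
have D1 b : is_diff z (fun y => D2 F y (h y) b)
    (fun a => 'd (fun y => D2 F y (h z) b) z a + D2 F z (dh a) b).
  exact: (is_diff_apply (G := fun y c => D2 F y c b)
    (dG := fun a c => 'd (fun y => D2 F y c b) z a) (Gl b)).
have Gr : \forall y \near z, linear (D2 F y (h y)).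
  by apply: (open_near Uo Uz) => y Uy; exact: D2_linr SF.
exact: (is_diff_apply (G := fun y b => D2 F y (h y) b)
  (dG := fun a b => 'd (fun y => D2 F y (h z) b) z a + D2 F z (dh a) b) Gr D1
    Dk).
Unshelve. all: by end_near. Qed.

End SecondDifferential.

Section Metric.
Context {R : realType} {n : nat} {M : manifold R n}.
Notation tr c d := (coord (charts M) d \o point (charts M) c).
Notation trS c d := (coord (SM M) d \o point (SM M) c).
Notation inr := (@inrmx R n n).
Implicit Types (u : bundle_pt M) (v w : tvec (charts M)).
Let HM := @charts_smooth R n M.
Let HS := @slit_smooth R n M.

(** The function L^2, twice the energy, in a chart of the slit bundle. *)
Definition sq_comp (L : bundle_pt M -> R) c :=
  (fun p => L p ^+ 2) \o point (SM M) c.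

(** The Finsler metric in the coordinates of a chart. *)
Definition hess (L : bundle_pt M -> R) c (z : 'rV[R]_(n + n)) (a b : 'rV[R]_n) :
  R :=
  2^-1 * D2 (sq_comp L c) z (inr a) (inr b).

Variable L : bundle_pt M -> R.
Hypothesis SL : smooth_fun (SM M) L.

Lemma sq_smooth c : smooth (rng (SM M) c) (sq_comp L c).
Proof.
move=> k; have Ro := at_open HS c.
exact: (Ck_scale Ro (SL c k) (SL c k)).
Qed.

Lemma hess_smooth c a b : smooth (rng (SM M) c) (fun z => hess L c z a b).
Proof.
move=> k; have Ro := at_open HS c.
exact: (Ck_scale Ro (Ck_cst k (2^-1 : R) Ro)
  (@D2_smooth _ _ _ _ (inr a) (inr b) (@sq_smooth c) k)).
Qed.

Lemma hess_sym c z a b : rng (SM M) c z -> hess L c z a b = hess L c z b a.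
Proof. by move=> zr; congr (_ * _); exact: D2_sym (at_open HS c) zr
  (sq_smooth c). Qed.

Lemma hess_linr c z a : rng (SM M) c z -> linear (hess L c z a).
Proof.
move=> zr k b b'; rewrite /hess linearP
  (D2_linr _ (at_open HS c) zr (sq_smooth c)).
by rewrite mulrDr -scalerAr.
Qed.

Lemma hessBl c z a a' b : hess L c z (a - a') b = hess L c z a b - hess L c z a'
  b.
Proof.
rewrite /hess -mulrBr; apply: (congr1 (fun t => 2^-1 * t)).
exact: etrans (congr1 ('d (fun y => 'd (sq_comp L c) y (inr b)) z)
  (linearB inr a a')) (linearB _ _ _).
Qed.

Lemma g_compE c u i j : dom (SM M) c u ->
  g_comp L c u i j = hess L c (coord (SM M) c u) (delta_mx 0 i) (delta_mx 0 j).
Proof.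
move=> cu; rewrite /g_comp /hess; congr (_ * _).
have zr := rng_coord cu.
have N : \forall z \near coord (SM M) c u,
    'D_(fibre_dir R j) (sq_comp L c) z = 'd (sq_comp L c) z
      (inr (delta_mx 0 j)).
  apply: (near_rng HS cu) => z zr'; rewrite deriveE //.
  exact: is_diff_ex (smooth_diff (sq_smooth c) zr').
rewrite (near_eq_derive _ N) deriveE //.
exact: is_diff_ex (smooth_diff (diff_smooth _ (sq_smooth c)) zr).
Qed.

Lemma hess_expand c z a b : rng (SM M) c z ->
  hess L c z a b = \sum_i \sum_j hess L c z (delta_mx 0 i) (delta_mx 0 j) * a 0
    i * b 0 j.
Proof.
move=> zr.
have linl : linear (fun c' => hess L c z c' b).
  by move=> k u v; rewrite hess_sym // hess_linr // !(hess_sym b).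
rewrite (linear_expand linl); apply: eq_bigr => i _.
rewrite (linear_expand (hess_linr _ zr)) scaler_sumr; apply: eq_bigr => j _.
by rewrite /GRing.scale /= mulrC [b 0 j * _]mulrC mulrAC.
Qed.

(** The term with the second differential of the transition map of the base has
    a vertical vector as argument, whose base component is zero. *)
Lemma hess_tr c d u a b : dom (SM M) c u -> dom (SM M) d u ->
  hess L c (coord (SM M) c u) a b = hess L d (coord (SM M) d u)
    ('d (tr c d) (coord (charts M) c u.1) a)
      ('d (tr c d) (coord (charts M) c u.1) b).
Proof.
move=> cu du; set z := coord (SM M) c u; set x := coord (charts M) c u.1.
have bc := dom_base cu; have bd := dom_base du.
have Ex : x = lsubmx z by rewrite /= row_mxKl.
have Ez : coord (SM M) d u = trS c d z.
  exact: (tr_coord HS d cu).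
have Dsq e y : rng (SM M) e y -> is_diff y (sq_comp L e) ('d (sq_comp L e) y).
  exact: (smooth_diff (sq_smooth e)).
(* The differential along a fibre: the fibre components of the transition map
   are linear, with coefficients that depend on the base point. *)
have near_fibre : \forall y \near z, 'd (sq_comp L c) y (inr b)
    = 'd (sq_comp L d) (trS c d y) (inr ('d (tr c d) (lsubmx y) b)).
  apply: (near_ovl HS cu du) => _ [u' [cu' du'] <-].
  have Ez' : coord (SM M) d u' = trS c d (coord (SM M) c u').
    exact: (tr_coord HS d cu').
  have D1 := is_diff_comp_at Ez' (tr_diff HS cu' du') (Dsq d _ (rng_coord du')).
  have E1 : 'd (sq_comp L c) (coord (SM M) c u') (inr b)
      = 'd (sq_comp L d \o trS c d) (coord (SM M) c u') (inr b).
    apply: near_eq_diffE; last exact: is_diff_ex (Dsq c _ (rng_coord cu')).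
    apply: (near_ovl HS cu' du') => y yo.
    exact: (congr1 (fun q => L q ^+ 2) (esym (point_tr HS yo))).
  apply: etrans E1 _; apply: etrans (is_diffE (inr b) D1) _.
  apply: (congr2 (fun y e => 'd (sq_comp L d) y e) Ez' _).
  apply: etrans (slit_tr_diff_fibre b cu' du') _.
  by rewrite /inrmx [lsubmx _]row_mxKl.
have Dz := rng_coord du.
have DG e : is_diff z (fun y => 'd (sq_comp L d) (trS c d y) e)
    (fun a => 'd (fun y => 'd (sq_comp L d) y e) (coord (SM M) d u)
      ('d (trS c d) z a)).
  have De := smooth_diff (diff_smooth e (@sq_smooth d)) Dz.
  exact: is_diff_comp_at Ez (tr_diff HS cu du) De.
have Gl : \forall y \near z, linear ('d (sq_comp L d) (trS c d y) :
  'rV[R]_(n + n) -> R).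
  by near=> y; exact: linearP.
have Dl := is_diff_linear lsubmx z.
have Dh : is_diff z (fun y => inr ('d (tr c d) (lsubmx y) b))
    (fun a => inr ('d (fun y => 'd (tr c d) y b) x (lsubmx a))).
  apply: is_diff_lin_comp.
  have [_ /(_ b)/CkSP[H _]] := CkSP (at_smooth HM c d 2%N).
  exact: is_diff_comp_at Ex Dl (differentiableP (H x (ovl_coord bc bd))).
have DD := is_diff_apply (G := fun y => 'd (sq_comp L d) (trS c d y))
  (dG := fun a e => 'd (fun y => 'd (sq_comp L d) y e) (coord (SM M) d u)
    ('d (trS c d) z a))
  Gl DG Dh.
have E2 : D2 (sq_comp L c) z (inr a) (inr b) = D2 (sq_comp L d)
  (coord (SM M) d u)
    ('d (trS c d) z (inr a)) (inr ('d (tr c d) (lsubmx z) b))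
    + 'd (sq_comp L d) (trS c d z) (inr
      ('d (fun y => 'd (tr c d) y b) x (lsubmx (inr a)))).
  apply: etrans (is_diffE (inr a) DD).
  apply: near_eq_diffE near_fibre _.
  exact: is_diff_ex (smooth_diff (diff_smooth (inr b) (sq_smooth c))
    (rng_coord cu)).
have E3 : 'd (sq_comp L d) (trS c d z)
  (inr ('d (fun y => 'd (tr c d) y b) x (lsubmx (inr a)))) = 0.
  have l0 : lsubmx (inr a) = 0 by rewrite row_mxKl.
  have l1 : 'd (fun y => 'd (tr c d) y b) x (lsubmx (inr a)) = 0.
    exact: etrans (congr1 ('d (fun y => 'd (tr c d) y b) x) l0) (linear0 _).
  have l2 : inr ('d (fun y => 'd (tr c d) y b) x (lsubmx (inr a))) = 0.
    exact: etrans (congr1 inr l1) (linear0 _).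
  exact: etrans (congr1 ('d (sq_comp L d) (trS c d z)) l2) (linear0 _).
apply: (congr1 (fun t => 2^-1 * t)).
have cancel (p q r : R) : q = 0 -> p = r -> p + q = r by move=> -> ->;
  rewrite addr0.
apply: etrans E2 _; apply: cancel E3 _.
apply: (congr2 (fun p q => D2 (sq_comp L d) (coord (SM M) d u) p q)).
  exact: slit_tr_diff_fibre.
by rewrite Ex.
Unshelve. all: by end_near. Qed.

Lemma metricE c u v w : dom (SM M) c u -> tangent (charts M) u.1 v ->
  tangent (charts M) u.1 w ->
  metric L u v w = hess L c (coord (SM M) c u) (v c) (w c).
Proof.
move=> cu vt wt.
have E d : dom (SM M) d u -> \sum_i \sum_j g_comp L d u i j * v d 0 i * w d 0 j
    = hess L d (coord (SM M) d u) (v d) (w d).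
  move=> du; rewrite (hess_expand (v d) (w d) (rng_coord du)).
  by apply: eq_bigr => i _; apply: eq_bigr => j _; rewrite g_compE.
rewrite /metric (in_chartE cu); first exact: E.
move=> d du; rewrite E // E // (hess_tr _ _ cu du).
by congr (hess _ _ _ _ _); apply: tangent_tr => //; exact: dom_base.
Qed.

End Metric.

Arguments sq_smooth {R n M L} SL c : rename.
Arguments hess_smooth {R n M L} SL c a b : rename.

(** * Euler's identities and Cartan's tensor *)

Section VerticalHessian.
Context {R : realType} {n : nat} {M : manifold R n}.
Notation inr := (@inrmx R n n).
Implicit Types (u : bundle_pt M) (v w : tvec (charts M)) (L : bundle_pt M -> R).
Let HM := @charts_smooth R n M.
Let HS := @slit_smooth R n M.

(** Twice Cartan's tensor: the derivative of the components of the metric along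
    the fibres. *)
Definition hess3 L c (z : 'rV[R]_(n + n)) (e a b : 'rV[R]_n) : R :=
  'd (fun y => hess L c y a b) z (inr e).

(** Euler's identity for L^2, which is homogeneous of degree 2. *)
Lemma euler_sq L c z : finsler L -> rng (SM M) c z ->
  'd (sq_comp L c) z (inr (rsubmx z)) = 2 * sq_comp L c z.
Proof.
move=> hL zr; have [cu zE] := point_rng HS zr; set u :=
  point (SM M) c z in cu zE.
have up := pts_dom cu.
have SL := finsler_smooth hL c.
have DL : is_diff z (L \o point (SM M) c) ('d (L \o point (SM M) c) z) :=
  smooth_diff SL zr.
have H := finsler_homogeneous hL up.
have ut := dom_fibre cu.
have dL : differentiable (L \o point (SM M) c) (coord (SM M) c u).
  by rewrite zE; exact: is_diff_ex DL.
rewrite (dir_derivE HS cu (gamma_tangent up ut) dL) in H.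
rewrite zE gamma_comp // in H.
have uc : u.2 c = rsubmx z by rewrite -zE /= row_mxKr.
rewrite uc in H.
have D2 := is_diff_scale DL DL.
apply: etrans (is_diffE (inr (rsubmx z)) D2) _.
have key (p q : R) : q = p -> p *: q + q *: p = 2 * (p * p).
  by move=> ->; rewrite /GRing.scale /= mulr_natl mulr2n.
exact: key.
Qed.

(** The derivative of [euler_sq] along the fibres. *)
Lemma euler_D2 L c z a : finsler L -> rng (SM M) c z ->
  D2 (sq_comp L c) z (inr a) (inr (rsubmx z)) = 'd (sq_comp L c) z (inr a).
Proof.
move=> hL zr; have Ro := at_open HS c.
have SF := sq_smooth (finsler_smooth hL) c.
have Dr := is_diff_lin_comp inr (is_diff_linear rsubmx z).
have D1 := is_diff_D1 Ro zr SF Dr.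
have DF := is_diffZ 2 (smooth_diff SF zr).
have N : \forall y \near z, 'd (sq_comp L c) y (inr (rsubmx y)) =
  (2 *: sq_comp L c) y.
  by apply: (open_near Ro zr) => y yr; exact: euler_sq.
have E := etrans (esym (is_diffE (inr a) D1))
  (etrans (near_eq_diffE (inr a) N (is_diff_ex D1)) (is_diffE (inr a) DF)).
have key (p q r s : R) : r = q -> s = 2 * q -> p + r = s -> p = q.
  by move=> -> ->; rewrite mulr_natl mulr2n => /addIr.
apply: key E; last by [].
by rewrite /= (rsub_inr (m := n) a).
Qed.

(** The derivative of [euler_D2] along the fibres: since the metric is
    homogeneous of degree 0, Cartan's tensor vanishes on the canonical
    section. *)
Lemma euler_hess3 L c z e a : finsler L -> rng (SM M) c z ->
  hess3 L c z e a (rsubmx z) = 0.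
Proof.
move=> hL zr; have Ro := at_open HS c.
have SL := finsler_smooth hL; have SF := sq_smooth SL c.
have Dr := is_diff_linear rsubmx z.
have Gl : \forall y \near z, linear (hess L c y a).
  by apply: (open_near Ro zr) => y yr; exact: hess_linr.
have Dh b : is_diff z (fun y => hess L c y a b)
  ('d (fun y => hess L c y a b) z).
  exact: smooth_diff (hess_smooth SL c a b) zr.
have D1 := is_diff_apply (G := fun y => hess L c y a)
  (dG := fun e b => 'd (fun y => hess L c y a b) z e) Gl Dh Dr.
have DF := is_diffZ (2^-1) (smooth_diff (diff_smooth (inr a) SF) zr).
have N : \forall y \near z, hess L c y a (rsubmx y)
    = (2^-1 *: (fun y => 'd (sq_comp L c) y (inr a)) : _ -> R) y.
  apply: (open_near Ro zr) => y yr.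
  exact: (congr1 (fun t => 2^-1 * t) (euler_D2 a hL yr)).
have E := etrans (esym (is_diffE (inr e) D1))
  (etrans (near_eq_diffE (inr e) N (is_diff_ex D1)) (is_diffE (inr e) DF)).
have key (p q r s : R) : q = r -> s = r -> p + q = s -> p = 0.
  by move=> -> ->; rewrite -[RHS]add0r => /addIr.
apply: key E; last exact: esym (hess_sym SL a e zr).
by rewrite /= (rsub_inr (m := n) e).
Qed.

(** The conformal factor is constant along the line [t *: inr e + z], which
    stays in a fibre. *)
Lemma conformal_hess3 (sigma : M -> R) L L' c z e a b :
  smooth_fun (SM M) L -> smooth_fun (SM M) L' -> conformal sigma L L' ->
  rng (SM M) c z ->
  hess3 L' c z e a b
  = expR (2 * sigma (point (charts M) c (lsubmx z))) * hess3 L c z e a b.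
Proof.
move=> SL SL' hc zr; have Ro := at_open HS c.
have hE y : rng (SM M) c y -> hess L' c y a b
    = expR (2 * sigma (point (charts M) c (lsubmx y))) * hess L c y a b.
  move=> yr; have [cu yE] := point_rng HS yr; set u :=
    point (SM M) c y in cu yE.
  have ta := of_comp_tangent HM a (dom_base cu).
  have tb := of_comp_tangent HM b (dom_base cu).
  have := hc u _ _ (pts_dom cu) ta tb.
  rewrite (metricE SL cu) // (metricE SL' cu) // yE !(of_comp_id HM) //;
    exact: dom_base.
have line K : smooth_fun (SM M) K ->
    is_diff (0 : R) (fun t => hess K c (t *: inr e + z) a b)
      (fun t => t *: hess3 K c z e a b).
  move=> SK; apply: (is_diff_line0 (f := fun y => hess K c y a b)).
  exact: is_diff_ex (smooth_diff (hess_smooth SK c a b) zr).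
set k := expR _.
have N : \forall t \near (0 : R), hess L' c (t *: inr e + z) a b
    = (k *: (fun t => hess L c (t *: inr e + z) a b)) t.
  have C : {for (0 : R), continuous (fun t : R => t *: inr e + z)}.
    apply: differentiable_continuous;
      exact: is_diff_ex (is_diff_line0 _ (is_diff_ex (is_diff_id z))).
  have Cz : \forall y \near (0 : R) *: inr e + z, rng (SM M) c y.
    by rewrite scale0r add0r; exact: open_nbhs_nbhs.
  have Ct : \forall t \near (0 : R), rng (SM M) c (t *: inr e + z) := C _ Cz.
  apply: filterS Ct => t yr; apply: etrans (hE _ yr) _.
  have -> : lsubmx (t *: inr e + z) = lsubmx z.
    by rewrite linearP /= lsub_inr scaler0 add0r.
  by [].
have D' := line _ SL'; have D := is_diffZ k (line _ SL).
have := etrans (esym (is_diffE (1 : R) D'))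
  (etrans (near_eq_diffE (1 : R) N (is_diff_ex D')) (is_diffE (1 : R) D)).
have key (p q : R) : 1 *: p = k *: (1 *: q) -> p = k * q by rewrite !scale1r.
exact: key.
Qed.

Lemma metric_deriv L c u (w : tvec (SM M)) (Y Z : pfield M) : smooth_fun (SM M)
  L ->
  dom (SM M) c u -> tangent (SM M) u w -> pi_field Y -> pi_field Z ->
  dir_deriv (SM M) u w (fun p => metric L p (Y p) (Z p))
  = 'd (fun y => hess L c y (Y u c) (Z u c)) (coord (SM M) c u) (w c)
    + hess L c (coord (SM M) c u)
        ('d (fun y => Y (point (SM M) c y) c) (coord (SM M) c u) (w c)) (Z u c)
    + hess L c (coord (SM M) c u) (Y u c)
        ('d (fun y => Z (point (SM M) c y) c) (coord (SM M) c u) (w c)).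
Proof.
move=> SL cu wt [tY sY] [tZ sZ]; set z := coord (SM M) c u.
have Ro := at_open HS c; have zr := rng_coord cu; have SF := sq_smooth SL c.
have DY : is_diff z (fun y => Y (point (SM M) c y) c)
  ('d (fun y => Y (point (SM M) c y) c) z).
  exact: smooth_diff (sY c) zr.
have DZ : is_diff z (fun y => Z (point (SM M) c y) c)
  ('d (fun y => Z (point (SM M) c y) c) z).
  exact: smooth_diff (sZ c) zr.
have DD := is_diffZ (2^-1) (is_diff_D2 Ro zr SF (is_diff_lin_comp inr DY)
  (is_diff_lin_comp inr DZ)).
have DH : is_diff z (fun y => hess L c y (Y u c) (Z u c))
  ('d (fun y => hess L c y (Y u c) (Z u c)) z).
  exact: smooth_diff (hess_smooth SL c (Y u c) (Z u c)) zr.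
have N : {near z, (2^-1 *: (fun y => D2 (sq_comp L c) y
  (inr (Y (point (SM M) c y) c)) (inr (Z (point (SM M) c y) c))) : _ -> R)
   =1 (fun p => metric L p (Y p) (Z p)) \o point (SM M) c}.
  apply: (open_near Ro zr) => y yr; have [cy yE] := point_rng HS yr.
  have py := pts_dom cy.
  apply/esym; apply: etrans (metricE SL cy (tY _ py) (tZ _ py)) _.
  exact: (congr1 (fun y' => hess L c y' (Y (point (SM M) c y) c)
    (Z (point (SM M) c y) c)) yE).
have DM := near_eq_is_diff N DD.
apply: etrans (dir_derivE HS cu wt (is_diff_ex DM)) _.
apply: etrans (is_diffE (w c) DM) _.
have DF : is_diff z (fun y => D2 (sq_comp L c) y (inr (Y u c)) (inr (Z u c)))
    ('d (fun y => D2 (sq_comp L c) y (inr (Y u c)) (inr (Z u c))) z).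
  exact: smooth_diff (D2_smooth _ _ SF) zr.
have pt : point (SM M) c z = u := at_coordK HS cu.
have E1 : 'd (fun y => hess L c y (Y u c) (Z u c)) z (w c)
    = 2^-1 * 'd (fun y => D2 (sq_comp L c) y (inr (Y u c)) (inr (Z u c))) z
      (w c).
  exact: (is_diffE (w c) (is_diffZ 2^-1 DF)).
have key (p q r s : R) : s = 2^-1 * p ->
  2^-1 *: (p + q + r) = s + 2^-1 * q + 2^-1 * r.
  by move=> ->; rewrite /GRing.scale /= !mulrDr.
rewrite -/z -[LHS]/(2^-1 *: ('d (fun y => D2 (sq_comp L c) y
      (inr (Y (point (SM M) c z) c)) (inr (Z (point (SM M) c z) c))) z (w c)
    + D2 (sq_comp L c) z (inr ('d (fun y => Y (point (SM M) c y) c) z (w c)))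
        (inr (Z (point (SM M) c z) c))
    + D2 (sq_comp L c) z (inr (Y (point (SM M) c z) c))
        (inr ('d (fun y => Z (point (SM M) c y) c) z (w c))))).
rewrite pt.
exact: key.
Qed.
End VerticalHessian.

(** * Smooth families of matrices *)

Lemma Ck_det {R : realType} k (V : normedModType R) (U : set V) m
  (E : V -> 'M[R]_m) :
  open U -> (forall i j, Ck k U (fun z => E z i j)) ->
    Ck k U (fun z => \det (E z)).
Proof.
move=> Uo CE.
have CS (s : 'S_m) : Ck k U (fun z => (-1) ^+ s * \prod_i E z i (s i)).
  apply: (Ck_scale Uo (Ck_cst k ((-1) ^+ s : R) Uo)).
  by apply: Ck_prod.
exact: (Ck_sum (index_enum 'S_m) Uo CS).
Qed.

(** Cramer's rule. *)
Lemma Ck_invmx {R : realType} k (V : normedModType R) (U : set V) m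
  (E : V -> 'M[R]_m) :
  open U -> (forall z, U z -> E z \in unitmx) ->
  (forall i j, Ck k U (fun z => E z i j)) ->
  forall i j, Ck k U (fun z => invmx (E z) i j).
Proof.
move=> Uo EU CE i j.
have Cd := Ck_det Uo CE.
have Ci : Ck k U (fun z => (\det (E z))^-1).
  by apply: Ck_inv => // z Uz; rewrite -unitfE; exact: EU.
have Cc : Ck k U (fun z => cofactor (E z) j i).
  apply: (Ck_scale Uo (Ck_cst k ((-1) ^+ (j + i) : R) Uo)).
  apply: Ck_det => // i' j'.
  by apply: Ck_ext (CE (lift j i') (lift i j')) => // z _; rewrite !mxE.
apply: Ck_ext (Ck_scale Uo Ci Cc) => // z Uz.
by rewrite /invmx EU // !mxE.
Qed.

(** * Fields along the projection *)

Section Fields.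
Context {R : realType} {n : nat} {M : manifold R n}.
Notation inr := (@inrmx R n n).
Notation inl := (@inlmx R n n).
Implicit Types (u : bundle_pt M) (v : tvec (charts M)) (w : tvec (SM M))
  (X Y Z : pfield M).
Let HM := @charts_smooth R n M.
Let HS := @slit_smooth R n M.

Lemma pi_field_ext Y Z : (forall u, pts (SM M) u -> Y u = Z u) -> pi_field Y ->
  pi_field Z.
Proof.
move=> YZ [tY sY]; split=> [u up|c k]; first by rewrite -YZ //; exact: tY.
apply: Ck_ext (sY c k); first exact: (at_open HS).
by move=> z zr; rewrite YZ //; exact: (pts_point HS).
Qed.

Lemma pi_fieldD Y Z : pi_field Y -> pi_field Z -> pi_field (Y + Z).
Proof.
move=> [tY sY] [tZ sZ]; split=> [u up|c k].
  by apply: tangentD; [exact: tY|exact: tZ].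
exact: Ck_add (at_open HS c) (sY c k) (sZ c k).
Qed.

Lemma pi_fieldN Y : pi_field Y -> pi_field (- Y).
Proof.
move=> [tY sY]; split=> [u up|c k]; first by apply: tangentN; exact: tY.
exact: Ck_opp (at_open HS c) (sY c k).
Qed.

Lemma pi_fieldB Y Z : pi_field Y -> pi_field Z -> pi_field (Y - Z).
Proof. by move=> pY pZ; apply: pi_fieldD => //; exact: pi_fieldN. Qed.

Lemma pi_field0 : pi_field (0 : pfield M).
Proof.
split=> [u up|c k]; first exact: tangent0.
exact: Ck_cst (at_open HS c).
Qed.

Lemma point_fibre c z : rng (SM M) c z -> (point (SM M) c z).2 c = rsubmx z.
Proof. by move=> zr; have [_ {2}<-] := point_rng HS zr;
  rewrite /= row_mxKr. Qed.

Lemma pi_field_eta : pi_field (@eta R n M).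
Proof.
split=> [u [c _ cu]|c k]; first exact: dom_fibre cu.
have Ro := at_open HS c.
apply: (Ck_ext Ro _ (Ck_linear k rsubmx Ro)) => z zr.
by rewrite /eta point_fibre.
Qed.

Lemma pi_field_rho (W : field M) : vector_field (SM M) W -> pi_field (rhof W).
Proof.
move=> [tW sW]; split=> [u up|c k]; first by apply: rho_tangent => //;
  exact: tW.
have Ro := at_open HS c.
apply: (Ck_ext Ro _ (Ck_lin_comp lsubmx Ro (sW c k))) => z zr.
have [cu _] := point_rng HS zr.
by rewrite /rhof (rho_comp cu) //; apply: tW; exact: pts_dom cu.
Qed.

Lemma vector_field_gamma X : pi_field X -> vector_field (SM M) (gammaf X).
Proof.
move=> [tX sX]; split=> [u up|c k]; first by apply: gamma_tangent => //;
  exact: tX.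
have Ro := at_open HS c.
apply: (Ck_ext Ro _ (Ck_lin_comp inr Ro (sX c k))) => z zr.
have [cu _] := point_rng HS zr.
by rewrite /gammaf gamma_comp.
Qed.

Lemma rhoB u w w' : pts (SM M) u -> tangent (SM M) u w -> tangent (SM M) u w' ->
  rho u (w - w') = rho u w - rho u w'.
Proof.
move=> up wt wt'; have := rho_lin (-1) up wt' wt.
by rewrite !scaleN1r addrC => ->; rewrite addrC.
Qed.

Lemma rhoN u w : pts (SM M) u -> tangent (SM M) u w -> rho u (- w) = - rho u w.
Proof.
move=> up wt; have t0 := tangent0 (A := SM M) (x := u).
have r0 : rho u 0 = 0 by have := rhoB up t0 t0; rewrite !subrr.
by have := rhoB up t0 wt; rewrite r0 !sub0r.
Qed.

Lemma gammaf_diff_base c u X (a : 'rV[R]_(n + n)) : pi_field X ->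
  dom (SM M) c u ->
  lsubmx ('d (fun z => gammaf X (point (SM M) c z) c) (coord (SM M) c u) a) = 0.
Proof.
move=> pX cu; have DG := is_diff_lin_comp lsubmx
  (is_diff_field (vector_field_gamma pX) cu).
apply: etrans (esym (is_diffE a DG)) _.
apply: etrans (near_eq_diffE (g := cst 0) _ _ (is_diff_ex DG)) _;
  last by rewrite diff_cst.
apply: (near_rng HS cu) => y /(point_rng HS)[cy _].
by rewrite /gammaf gamma_comp // /= row_mxKl.
Qed.

(** The base components of a vertical lift are identically zero, and so are
    their derivatives. *)
Lemma rho_bracket_gamma X Y u : pi_field X -> pi_field Y -> pts (SM M) u ->
  rhof (bracket (SM M) (gammaf X) (gammaf Y)) u = 0.
Proof.
move=> pX pY up; have := up => -[c _ cu].
have bt := bracket_tangent HS (vector_field_gamma pX) (vector_field_gamma pY)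
  up.
apply: (tangent_eq (dom_base cu)); [exact: rho_tangent|exact: tangent0|].
apply: etrans (rho_comp cu bt) _.
apply: etrans (congr1 lsubmx (bracketE _ _ cu)) _.
apply: etrans (linearB lsubmx _ _) _.
have key (p q : 'rV[R]_n) : p = 0 -> q = 0 -> p - q = 0 by move=> -> ->;
  rewrite subrr.
exact: key (gammaf_diff_base _ pY cu) (gammaf_diff_base _ pX cu).
Qed.

Lemma rhof_gammaf X u : pi_field X -> pts (SM M) u -> rhof (gammaf X) u = 0.
Proof. by move=> pX up; apply: rho_gamma => //; exact: pX.1. Qed.

End Fields.

(** * Regular connections *)

Section Connection.
Context {R : realType} {n : nat} {M : manifold R n}.
Notation inr := (@inrmx R n n).
Notation inl := (@inlmx R n n).
Implicit Types (u : bundle_pt M) (v : tvec (charts M)) (w : tvec (SM M))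
  (X Y Z : pfield M) (W : field M).
Let HM := @charts_smooth R n M.
Let HS := @slit_smooth R n M.
Variable D : connection M.
Hypothesis HD : linear_connection D.

(** The indicator function f of the complement of the slit bundle is smooth on
    the slit bundle and satisfies Z = f Z; Leibniz' rule for f Z does the
    rest. *)
Lemma conn_vanish Z u w : pi_field Z -> (forall p, pts (SM M) p -> Z p = 0) ->
  pts (SM M) u -> tangent (SM M) u w -> D Z u w = 0.
Proof.
move=> pZ Z0 up wt.
pose f (p : bundle_pt M) : R := if `[< pts (SM M) p >] then 0 else 1.
have f0 p : pts (SM M) p -> f p = 0 by rewrite /f; case: asboolP.
have sf : smooth_fun (SM M) f.
  move=> c k; have Ro := at_open HS c.
  apply: (Ck_ext Ro _ (Ck_cst k (0 : R) Ro)) => z zr.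
  by rewrite /= f0 //; exact: (pts_point HS).
have ZE : (fun p => f p *: Z p) = Z.
  apply/funext => p; rewrite /f; case: asboolP => pp; last by rewrite scale1r.
  by rewrite Z0 // scaler0.
have := conn_leibniz HD sf pZ up wt.
by rewrite ZE Z0 // scaler0 f0 // scale0r addr0.
Qed.

Lemma conn_sectB Z Z' u w : pi_field Z -> pi_field Z' -> pts (SM M) u ->
  tangent (SM M) u w ->
  D (Z - Z') u w = D Z u w - D Z' u w.
Proof.
move=> pZ pZ' up wt.
have := conn_add HD (pi_fieldB pZ pZ') pZ' up wt.
by rewrite subrK => ->; rewrite addrK.
Qed.

Lemma conn_local Z Z' u w : pi_field Z ->
  (forall p, pts (SM M) p -> Z p = Z' p) ->
  pts (SM M) u -> tangent (SM M) u w -> D Z u w = D Z' u w.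
Proof.
move=> pZ ZZ' up wt; have pZ' := pi_field_ext ZZ' pZ.
apply/eqP; rewrite -subr_eq0 -conn_sectB //; apply/eqP.
apply: conn_vanish => //; first exact: pi_fieldB.
by move=> p pp; rewrite -[LHS]/(Z p - Z' p) ZZ' // subrr.
Qed.

Lemma conn_vecD Z u w w' : pi_field Z -> pts (SM M) u -> tangent (SM M) u w ->
  tangent (SM M) u w' -> D Z u (w + w') = D Z u w + D Z u w'.
Proof. by move=> pZ up wt wt'; have := conn_linear HD 1 pZ up wt wt';
  rewrite !scale1r. Qed.

Lemma conn_vec0 Z u : pi_field Z -> pts (SM M) u -> D Z u 0 = 0.
Proof.
move=> pZ up; have := conn_vecD pZ up (tangent0 (A := SM M) (x := u))
  (tangent0 (A := SM M) (x := u)).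
by rewrite addr0 => /eqP; rewrite -[X in X == _]addr0 => /eqP/addrI <-.
Qed.

Lemma conn_vecB Z u w w' : pi_field Z -> pts (SM M) u -> tangent (SM M) u w ->
  tangent (SM M) u w' -> D Z u (w - w') = D Z u w - D Z u w'.
Proof.
move=> pZ up wt wt'.
have := conn_vecD pZ up (tangentB wt wt') wt'.
by rewrite subrK => ->; rewrite addrK.
Qed.

Lemma conn_comp_lin Z c u : pi_field Z -> dom (SM M) c u ->
  linear (fun e => D Z u (of_comp (SM M) u c e) c).
Proof.
move=> pZ cu k e e'; rewrite of_comp_lin.
by rewrite (conn_linear HD) //; solve
  [exact: pts_dom cu | exact: (of_comp_tangent HS)].
Qed.

(** In a chart, the derivative along W is the value at the components of W of a
    smooth family of linear maps. *)
Lemma pi_field_nab W Z : vector_field (SM M) W -> pi_field Z ->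
  pi_field (nab D W Z).
Proof.
move=> [tW sW] pZ; split=> [u up|c k].
  by apply: (conn_tangent HD) => //; exact: tW.
have Ro := at_open HS c.
have Gl z : rng (SM M) c z -> linear
  (fun e => D Z (point (SM M) c z) (of_comp (SM M) (point (SM M) c z) c e) c).
  by move=> /(point_rng HS)[cu _]; exact: conn_comp_lin.
have CG e := conn_smooth HD c e pZ k.
apply: (Ck_ext Ro _ (Ck_apply Ro Gl CG (sW c k))) => z /(point_rng HS)[cu _].
by rewrite /nab -(tW _ (pts_dom cu) c cu).
Qed.

Lemma nab_sectB W Z Z' u : vector_field (SM M) W -> pi_field Z -> pi_field Z' ->
  pts (SM M) u ->
  nab D W (Z - Z') u = nab D W Z u - nab D W Z' u.
Proof. by move=> vW pZ pZ' up; apply: conn_sectB => //; exact: vW.1. Qed.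

Lemma pi_field_torsion W W' : vector_field (SM M) W -> vector_field (SM M) W' ->
  pi_field (torsion D W W').
Proof.
move=> vW vW'; apply: pi_fieldB; first by apply: pi_fieldB;
  apply: pi_field_nab => //; exact: pi_field_rho.
exact: pi_field_rho (vector_field_bracket HS vW vW').
Qed.

Section Regular.
Hypothesis HR : regular D.

(** A lift of v, such as the one with zero fibre components, minus its vertical
    part. *)
Lemma beta_ex u v : pts (SM M) u -> tangent (charts M) u.1 v ->
  exists w, [/\ tangent (SM M) u w, deflection D u w = 0 & rho u w = v].
Proof.
move=> up vt; have := up => -[c _ cu].
have wt := of_comp_tangent HS (inl (v c)) cu; set w0 := of_comp _ _ _ _ in wt.
have r0 : rho u w0 = v.
  apply: (tangent_eq (dom_base cu)) => //; first exact: rho_tangent.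
  by rewrite (rho_comp cu) // /w0 (of_comp_id HS) // row_mxKl.
have [/(_ _ wt)[a [b [[at_ ra] [bt Kb] w0E]]] _] := HR up.
exists b; split => //.
have := rho_lin 1 up at_ bt; rewrite !scale1r ra add0r => <-.
by rewrite -w0E.
Qed.

Lemma betaP u v : pts (SM M) u -> tangent (charts M) u.1 v ->
  [/\ tangent (SM M) u (beta D u v),
    deflection D u (beta D u v) = 0 & rho u (beta D u v) = v].
Proof.
move=> up vt; rewrite /beta; case: xgetP => [w _ //|H].
by have [w] := beta_ex up vt; move=> /(H w).
Qed.

Lemma beta_unique u v w : pts (SM M) u -> tangent (charts M) u.1 v ->
  tangent (SM M) u w -> deflection D u w = 0 -> rho u w = v -> beta D u v = w.
Proof.
move=> up vt wt Kw rw; have [bt Kb rb] := betaP up vt.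
have [_ H] := HR up.
apply/eqP; rewrite -subr_eq0; apply/eqP; apply: H.
- exact: tangentB.
- by rewrite rhoB // rb rw subrr.
- by rewrite /deflection conn_vecB //;
  [rewrite -!/(deflection _ _ _) Kb Kw subrr|exact: pi_field_eta].
Qed.

Lemma betaB u v v' : pts (SM M) u -> tangent (charts M) u.1 v ->
  tangent (charts M) u.1 v' ->
  beta D u (v - v') = beta D u v - beta D u v'.
Proof.
move=> up vt vt'; have [bt Kb rb] := betaP up vt; have [bt' Kb' rb'] :=
  betaP up vt'.
apply: beta_unique => //; try exact: tangentB.
  by rewrite /deflection conn_vecB //;
    [rewrite -!/(deflection _ _ _) Kb Kb' subrr|exact: pi_field_eta].
by rewrite rhoB // rb rb'.
Qed.

Lemma beta0 u : pts (SM M) u -> beta D u 0 = 0.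
Proof.
move=> up; have := betaB up (tangent0 (A := charts M) (x := u.1))
  (tangent0 (A := charts M) (x := u.1)).
by rewrite !subrr.
Qed.

(** In a chart, rho (a, b) = a and K (a, b) = A a + b E, where regularity makes
    the matrix E invertible; therefore beta X = (X, - (A X) E^-1). *)
Lemma vector_field_beta X : pi_field X -> vector_field (SM M) (betaf D X).
Proof.
move=> pX; split=> [u up|c k]; first by have [] := betaP up (pX.1 u up).
have Ro := at_open HS c; set U := rng (SM M) c in Ro *.
pose P z := point (SM M) c z.
pose K z (e : 'rV[R]_(n + n)) := D (@eta R n M) (P z) (of_comp (SM M) (P z) c e)
  c.
have Kl z : U z -> linear (K z).
  by move=> /(point_rng HS)[cu _]; apply: conn_comp_lin => //;
    exact: pi_field_eta.
have CK e : Ck k U (K ^~ e) := conn_smooth HD c e (pi_field_eta (M := M)) k.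
pose E z : 'M[R]_n := \matrix_(i, j) K z (inr (delta_mx 0 i)) 0 j.
have KE z b : U z -> K z (inr b) = b *m E z.
  move=> Uz.
  have l : linear (fun b => K z (inr b)) by move=> a p q; rewrite linearP Kl.
  apply: etrans (linear_expand l b) _; apply/rowP => j.
  by rewrite summxE !mxE; apply: eq_bigr => i _; rewrite !mxE.
(* Regularity: a vertical vector without deflection is zero. *)
have EU z : U z -> E z \in unitmx.
  move=> Uz; rewrite -row_free_unit; apply: inj_row_free => b bE.
  have [cu _] := point_rng HS Uz; have up := pts_dom cu.
  have tw := of_comp_tangent HS (inr b) cu.
  have [_ /(_ _ tw) H] := HR up.
  have w0 : of_comp (SM M) (P z) c (inr b) = 0.
    apply: H.
      apply: (tangent_eq (dom_base cu)); [exact: rho_tangent|exact: tangent0|].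
      by rewrite (rho_comp cu) // (of_comp_id HS) // lsub_inr.
    apply: (tangent_eq (dom_base cu)).
    - exact: (conn_tangent HD) (pi_field_eta (M := M)) up tw.
    - exact: tangent0.
    - by rewrite -[LHS]/(K z (inr b)) KE // bE.
  have := congr1 (@^~ c) w0; rewrite (of_comp_id HS) // => /(congr1 rsubmx).
  by rewrite rsub_inr => ->; exact: linear0.
have CE i j : Ck k U (fun z => E z i j).
  by apply: Ck_ext (Ck_coord j Ro (CK (inr (delta_mx 0 i)))) => // z _;
    rewrite mxE.
have CX := pX.2 c k.
have CA : Ck k U (fun z => K z (inl (X (P z) c))).
  exact: Ck_apply Ro Kl CK (Ck_lin_comp inl Ro CX).
have CB : Ck k U (fun z => - (K z (inl (X (P z) c)) *m invmx (E z))).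
  apply: Ck_opp => //; apply: Ck_rV => // j.
  apply: (@Ck_ext _ _ _ _ _ (fun z => \sum_i K z (inl (X (P z) c)) 0 i *: invmx
    (E z) i j)) => //.
    by move=> z _; rewrite mxE.
  apply: Ck_sum => // i; apply: Ck_scale => //; first exact: Ck_coord.
  exact: Ck_invmx.
apply: (Ck_ext Ro _ (Ck_row_mx Ro CX CB)) => z Uz.
have [cu _] := point_rng HS Uz; have up := pts_dom cu.
set e := row_mx _ _.
have tw := of_comp_tangent HS e cu; have tX := pX.1 _ up.
suff -> : betaf D X (P z) = of_comp (SM M) (P z) c e by rewrite (of_comp_id HS).
apply: beta_unique => //.
  apply: (tangent_eq (dom_base cu));
    first exact: (conn_tangent HD) (pi_field_eta (M := M)) up tw.
    exact: tangent0.
  rewrite /deflection -/(K z e) /e row_mxE.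
  have -> : K z (inl (X (P z) c) + inr
    (- (K z (inl (X (P z) c)) *m invmx (E z))))
     = K z (inl (X (P z) c)) + K z (inr
       (- (K z (inl (X (P z) c)) *m invmx (E z)))).
    by have := Kl z Uz 1 (inl (X (P z) c))
      (inr (- (K z (inl (X (P z) c)) *m invmx (E z)))); rewrite !scale1r.
  by rewrite KE // mulNmx mulmxKV ?EU // subrr.
apply: (tangent_eq (dom_base cu)) => //; first exact: rho_tangent.
by rewrite (rho_comp cu) // (of_comp_id HS) // /e row_mxKl.
Qed.

Lemma pi_field_deflection W : vector_field (SM M) W ->
  pi_field (nab D W (@eta R n M)).
Proof. by move=> vW; apply: pi_field_nab => //; exact: pi_field_eta. Qed.

Lemma rhof_betaf X u : pi_field X -> pts (SM M) u -> rhof (betaf D X) u = X u.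
Proof. by move=> pX up; have [] := betaP up (pX.1 u up). Qed.

(** The bracket of gamma X and beta Y has base components the derivatives of
    those of Y along gamma X, whatever the connection. Thus the mixed torsion
    and the vertical part of the connection determine each other. *)
Lemma Ttor_comp c u X Y : pi_field X -> pi_field Y -> dom (SM M) c u ->
  Ttor D X Y u c = nab D (gammaf X) Y u c
    - 'd (fun z => Y (point (SM M) c z) c) (coord (SM M) c u) (inr (X u c)).
Proof.
move=> pX pY cu; have up := pts_dom cu.
have vG := vector_field_gamma pX; have vB := vector_field_beta pY.
set z := coord (SM M) c u; have zr : rng (SM M) c z := rng_coord cu.
have E1 : nab D (gammaf X) (rhof (betaf D Y)) u = nab D (gammaf X) Y u.
  apply: conn_local => //; [exact: pi_field_rho|by move=> p;
    exact: rhof_betaf|exact: vG.1].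
have E2 : nab D (betaf D Y) (rhof (gammaf X)) u = 0.
  apply: conn_vanish => //; [exact: pi_field_rho|by move=> p;
    exact: rhof_gammaf|exact: vB.1].
have Ro := at_open HS c.
have DB := is_diff_lin_comp lsubmx (is_diff_field vB cu).
have E3 : rhof (bracket (SM M) (gammaf X) (betaf D Y)) u c
    = 'd (fun z => Y (point (SM M) c z) c) z (inr (X u c)).
  have bt := bracket_tangent HS vG vB up.
  apply: etrans (rho_comp cu bt) _.
  apply: etrans (congr1 lsubmx (bracketE _ _ cu)) _.
  apply: etrans (linearB lsubmx _ _) _.
  have F1 : lsubmx ('d (fun z => betaf D Y (point (SM M) c z) c) z
    (gammaf X u c))
     = 'd (fun z => Y (point (SM M) c z) c) z (inr (X u c)).
    rewrite /gammaf gamma_comp //.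
    apply: etrans (esym (is_diffE (inr (X u c)) DB)) _.
    apply: near_eq_diffE (is_diff_ex DB).
    apply: (open_near Ro zr) => y /(point_rng HS)[cy _].
    have [bt' _ rb] := betaP (pts_dom cy) (pY.1 _ (pts_dom cy)).
    exact: etrans (esym (rho_comp cy bt')) (congr1 (@^~ c) rb).
  have F2 := gammaf_diff_base (betaf D Y u c) pX cu.
  have key (p q r : 'rV[R]_n) : p = q -> r = 0 -> p - r = q by move=> -> ->;
    rewrite subr0.
  exact: key F1 F2.
have key (p q r p' r' : 'rV[R]_n) : p = p' -> q = 0 -> r = r' ->
  p - q - r = p' - r'.
  by move=> -> -> ->; rewrite subr0.
exact: key (congr1 (@^~ c) E1) (congr1 (@^~ c) E2) E3.
Qed.

End Regular.
End Connection.

(** * Cartan connections *)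

Section Cartan.
Context {R : realType} {n : nat} {M : manifold R n}.
Notation inr := (@inrmx R n n).
Implicit Types (u : bundle_pt M) (X Y Z : pfield M) (W : field M).
Let HM := @charts_smooth R n M.
Let HS := @slit_smooth R n M.
Variables (L : bundle_pt M -> R) (D : connection M).
Hypotheses (hL : finsler L) (hD : cartan_connection L D).
Let SL := finsler_smooth hL.
Let HD := cartan_linear hD.
Let HR := cartan_regular hD.

Lemma pi_field_Ttor X Y : pi_field X -> pi_field Y -> pi_field (Ttor D X Y).
Proof. by move=> pX pY; apply: pi_field_torsion => //;
  [exact: vector_field_gamma|exact: vector_field_beta]. Qed.

Lemma metric_nondeg (T : pfield M) u : pi_field T -> pts (SM M) u ->
  metric L u (T u) (T u) = 0 -> T u = 0.
Proof.
move=> pT up T0; apply: contrapT => Tn.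
by have := finsler_posdef hL up (pT.1 u up) Tn; rewrite T0 ltxx.
Qed.

(** Metricity along gamma X expresses the vertical derivative of g as the sum of
    g (T(X, Y), Z) and g (Y, T(X, Z)), which the last axiom of a Cartan
    connection makes equal. *)
Lemma metric_Ttor c u X Y Z : pi_field X -> pi_field Y -> pi_field Z ->
  dom (SM M) c u ->
  metric L u (Ttor D X Y u) (Z u)
  = 2^-1 * hess3 L c (coord (SM M) c u) (X u c) (Y u c) (Z u c).
Proof.
move=> pX pY pZ cu; have up := pts_dom cu.
have vG := vector_field_gamma pX; have zr := rng_coord cu.
set z := coord (SM M) c u in zr *.
pose h := hess L c z.
have hs a b : h a b = h b a by exact: hess_sym.
have hB a a' b : h (a - a') b = h a b - h a' b by exact: hessBl.
have TE Y' Z' : pi_field Y' -> pi_field Z' -> metric L u (Ttor D X Y' u) (Z' u)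
    = h (nab D (gammaf X) Y' u c) (Z' u c)
      - h ('d (fun y => Y' (point (SM M) c y) c) z (inr (X u c))) (Z' u c).
  move=> pY' pZ'.
  apply: etrans (metricE SL cu ((pi_field_Ttor pX pY').1 u up) (pZ'.1 u up)) _.
  apply: etrans (congr1 (fun t => h t (Z' u c)) (Ttor_comp HD HR pX pY' cu)) _.
  exact: hB.
have H1 := cartan_metric hD vG pY pZ up.
have H2 := metric_deriv SL cu (vG.1 u up) pY pZ.
have gE : gammaf X u c = inr (X u c) by rewrite /gammaf gamma_comp.
rewrite gE in H2.
have tN Y' : pi_field Y' -> tangent (charts M) u.1 (nab D (gammaf X) Y' u).
  by move=> pY'; exact: (pi_field_nab HD vG pY').1.
have M1 := metricE SL cu (tN _ pY) (pZ.1 u up).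
have M2 := metricE SL cu (pY.1 u up) (tN _ pZ).
have H3 := cartan_T hD pX pY pZ up.
have T1 := TE _ _ pY pZ; have T2 := TE _ _ pZ pY.
have key (t t' a b p q e : R) : t = t' -> t = a - p -> t' = b - q ->
    a + b = e + p + q -> t = 2^-1 * e.
  move=> tt t1 t2 E; have e2 : e = t + t.
    rewrite {2}tt t1 t2 (_ : _ + _ = a + b - p - q); last by ring.
    by rewrite E; ring.
  by rewrite e2 -mulr2n -[t *+ 2]mulr_natl mulKf // pnatr_eq0.
apply: key H3 T1 (etrans T2 (congr2 (fun p q => p - q) (hs _ _) (hs _ _))) _.
exact: etrans (esym (congr2 (fun p q => p + q) M1 M2)) (etrans (esym H1) H2).
Qed.

(** g (T(X, eta), Z) = g (T(X, Z), eta) is a value of Cartan's tensor on eta;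
    take for Z the section T(X, eta). *)
Lemma Ttor_eta X u : pi_field X -> pts (SM M) u -> Ttor D X (@eta R n M) u = 0.
Proof.
move=> pX up; have pE := pi_field_eta (M := M); have pT := pi_field_Ttor pX pE.
have := up => -[c _ cu]; have zr := rng_coord cu.
apply: metric_nondeg => //.
apply: etrans (cartan_T hD pX pE pT up) _.
apply: etrans (metric_Ttor pX pT pE cu) _.
have uE : @eta R n M u c = rsubmx (coord (SM M) c u) by rewrite /eta /=
  row_mxKr.
by rewrite uE euler_hess3 // mulr0.
Qed.

(** The components of eta are the fibre coordinates, so T(X, eta) is the
    difference of the two sides. *)
Lemma deflection_gamma X u : pi_field X -> pts (SM M) u ->
  nab D (gammaf X) (@eta R n M) u = X u.
Proof.
move=> pX up; have pE := pi_field_eta (M := M).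
have := up => -[c _ cu]; have zr := rng_coord cu.
have vG := vector_field_gamma pX.
apply: (tangent_eq (dom_base cu)); [exact: (pi_field_nab HD vG pE).1|exact:
  pX.1|].
have T0 := congr1 (@^~ c) (Ttor_eta pX up).
have TE := Ttor_comp HD HR pX pE cu.
have E : 'd (fun z => @eta R n M (point (SM M) c z) c) (coord (SM M) c u)
  (inr (X u c)) = X u c.
  have Dr := is_diff_linear rsubmx (coord (SM M) c u).
  have N : {near coord (SM M) c u, (rsubmx : 'rV[R]_(n + n) -> 'rV[R]_n)
      =1 (fun z => @eta R n M (point (SM M) c z) c)}.
    by apply: (near_rng HS cu) => y yr; rewrite /eta point_fibre.
  apply: etrans (is_diffE _ (near_eq_is_diff N Dr)) _.
  exact: rsub_inr.
have key (t a d x : 'rV[R]_n) : t = 0 -> t = a - d -> d = x -> a = x.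
  by move=> -> /esym/eqP; rewrite subr_eq0 => /eqP ->.
exact: key T0 TE E.
Qed.

(** The field W - gamma (K W) projects to rho W and has zero deflection, by
    [deflection_gamma]. *)
Lemma field_decomposition W u : vector_field (SM M) W -> pts (SM M) u ->
  W u = betaf D (rhof W) u + gammaf (nab D W (@eta R n M)) u.
Proof.
move=> vW up; have pE := pi_field_eta (M := M).
have pK := pi_field_nab HD vW pE; have pr := pi_field_rho vW.
have tW := vW.1 u up; have tr := pr.1 u up.
have [tb Kb rb] := betaP HR up tr.
have tg := (vector_field_gamma pK).1 u up.
suff : W u - gammaf (nab D W (@eta R n M)) u = betaf D (rhof W) u.
  by move=> <-; rewrite subrK.
apply/esym/(beta_unique HD HR) => //; first exact: tangentB.
  rewrite /deflection (conn_vecB HD) //.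
  have := deflection_gamma pK up; rewrite /nab => ->.
  by rewrite subrr.
rewrite rhoB // -[rho u (gammaf _ u)]/(rhof _ u) rhof_gammaf // subr0.
by [].
Qed.

End Cartan.

(** * Conformal Cartan connections *)

Section Conformal.
Context {R : realType} {n : nat} {M : manifold R n}.
Implicit Types (u : bundle_pt M) (X Y Z : pfield M) (W : field M).
Let HM := @charts_smooth R n M.
Let HS := @slit_smooth R n M.
Variables (L L' : bundle_pt M -> R) (sigma : M -> R) (D D' : connection M).
Hypotheses (hL : finsler L) (hL' : finsler L') (hconf : conformal sigma L L').
Hypotheses (hD : cartan_connection L D) (hD' : cartan_connection L' D').
Let HD := cartan_linear hD.
Let HD' := cartan_linear hD'.
Let HR := cartan_regular hD.
Let HR' := cartan_regular hD'.

(** Cartan's tensor is multiplied by the same factor as the metric. The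
    difference of the torsions serves as the test section. *)
Lemma Ttor_conformal X Y u : pi_field X -> pi_field Y -> pts (SM M) u ->
  Ttor D' X Y u = Ttor D X Y u.
Proof.
move=> pX pY up; have := up => -[c _ cu]; have zr := rng_coord cu.
have pT := pi_field_Ttor hD pX pY; have pT' := pi_field_Ttor hD' pX pY.
have pB := pi_fieldB pT' pT.
apply/eqP; rewrite -subr_eq0; apply/eqP.
apply: (metric_nondeg hL pB up).
set Z := Ttor D' X Y - Ttor D X Y.
have tZ := pB.1 u up.
have E : metric L u (Ttor D' X Y u) (Z u) = metric L u (Ttor D X Y u) (Z u).
  have k0 : expR (2 * sigma u.1) != 0 by rewrite gt_eqF // expR_gt0.
  have sE : sigma (point (charts M) c (lsubmx (coord (SM M) c u))) = sigma u.1.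
    by rewrite /= row_mxKl coordK //; exact: dom_base.
  have A1 := metric_Ttor hL' hD' pX pY pB cu.
  have A2 := metric_Ttor hL hD pX pY pB cu.
  have A3 := conformal_hess3 (X u c) (Y u c) (Z u c) (finsler_smooth hL)
    (finsler_smooth hL') hconf zr.
  have key (k k' p q r r' : R) : k = k' -> p = 2^-1 * r' -> r' = k * r ->
      q = 2^-1 * r -> p = k' * q.
    by move=> -> -> -> ->; rewrite mulrCA.
  have A4 := key _ _ _ _ _ _ (congr1 (fun s => expR (2 * s)) sE) A1 A3 A2.
  have A5 := hconf up (pT'.1 u up) tZ.
  apply: (mulfI k0).
  exact (etrans (esym A5) A4).
have M0 := metricE (finsler_smooth hL) cu tZ tZ.
have M1 := metricE (finsler_smooth hL) cu (pT.1 u up) tZ.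
have M2 := metricE (finsler_smooth hL) cu (pT'.1 u up) tZ.
apply: etrans M0 _; apply: etrans (hessBl _ _ _ _ _ _) _.
apply/eqP; rewrite subr_eq0; apply/eqP.
exact: etrans (esym M2) (etrans E M1).
Qed.

(** By [Ttor_comp], equal mixed torsions mean equal derivatives along vertical
    lifts. *)
Lemma nab_gamma X Z u : pi_field X -> pi_field Z -> pts (SM M) u ->
  nab D' (gammaf X) Z u = nab D (gammaf X) Z u.
Proof.
move=> pX pZ up; have := up => -[c _ cu]; have vG := vector_field_gamma pX.
apply: (tangent_eq (dom_base cu));
  [exact: (pi_field_nab HD' vG pZ).1|exact: (pi_field_nab HD vG pZ).1|].
have E := congr1 (@^~ c) (Ttor_conformal pX pZ up).
have T := Ttor_comp HD HR pX pZ cu; have T' := Ttor_comp HD' HR' pX pZ cu.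
have := etrans (esym T') (etrans E T).
exact: addIr.
Qed.

(** In the decomposition of W, only the horizontal part contributes to the
    difference of the connections. *)
Lemma nab_Bdiff W Z u : vector_field (SM M) W -> pi_field Z -> pts (SM M) u ->
  nab D' W Z u = nab D W Z u + Bdiff D D' (rhof W) Z u.
Proof.
move=> vW pZ up.
have pK := pi_field_deflection HD vW; have pr := pi_field_rho vW.
have tb := (vector_field_beta HD HR pr).1 u up; have tg :=
  (vector_field_gamma pK).1 u up.
rewrite /Bdiff /omega.
rewrite -[(nab D' _ Z - _) u]/(nab D' (betaf D (rhof W)) Z u - nab D
  (betaf D (rhof W)) Z u).
have G := nab_gamma pK pZ up.
have S := field_decomposition hL hD vW up.
have -> : nab D' W Z u = nab D' (betaf D (rhof W)) Z u
    + nab D' (gammaf (nab D W (@eta R n M))) Z u.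
  by rewrite {1}/nab S (conn_vecD HD').
have -> : nab D W Z u = nab D (betaf D (rhof W)) Z u
    + nab D (gammaf (nab D W (@eta R n M))) Z u.
  by rewrite {1}/nab {1}S (conn_vecD HD).
by rewrite G [RHS]addrC addrA subrK.
Qed.

Lemma pi_field_Bdiff X Z : pi_field X -> pi_field Z ->
  pi_field (Bdiff D D' X Z).
Proof.
move=> pX pZ; have vB := vector_field_beta HD HR pX.
by apply: pi_fieldB; [exact: (pi_field_nab HD')|exact: (pi_field_nab HD)].
Qed.

Lemma pi_field_Ndiff X : pi_field X -> pi_field (Ndiff D D' X).
Proof. by move=> pX; apply: pi_field_Bdiff => //; exact: pi_field_eta. Qed.

(** The deflection of beta X for D' is N X, which is also that of gamma (N
    X). *)
Lemma beta_conformal X u : pi_field X -> pts (SM M) u ->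
  betaf D' X u = betaf D X u - gammaf (Ndiff D D' X) u.
Proof.
move=> pX up; have pE := pi_field_eta (M := M).
have pN := pi_field_Ndiff pX; have tX := pX.1 u up.
have [tb Kb rb] := betaP HR up tX.
have tg := (vector_field_gamma pN).1 u up.
apply: (beta_unique HD' HR') => //; first exact: tangentB.
  rewrite /deflection (conn_vecB HD') //.
  have := deflection_gamma hL' hD' pN up; rewrite {1}/nab => ->.
  rewrite /Ndiff /Bdiff /omega.
  rewrite -[(nab D' _ _ - _) u]/(D' (@eta R n M) u (beta D u (X u)) - deflection
    D u (beta D u (X u))).
  by rewrite Kb subr0 subrr.
rewrite rhoB // -[rho u (gammaf _ u)]/(rhof _ u) rhof_gammaf // subr0.
by [].
Qed.

End Conformal.

(** * Torsion and curvature as bilinear expressions *)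

Ltac tvec_ring := apply/funext => c; apply/rowP => i; rewrite ?fctE ?mxE; ring.

Section Bilinear.
Context {R : realType} {n : nat} {M : manifold R n}.
Implicit Types (u : bundle_pt M) (X Y Z : pfield M) (V W : field M).
Let HM := @charts_smooth R n M.
Let HS := @slit_smooth R n M.
Variable D : connection M.
Hypothesis HD : linear_connection D.

Lemma nab_fieldB V V' Z u : vector_field (SM M) V -> vector_field (SM M) V' ->
  pi_field Z ->
  pts (SM M) u -> nab D (V - V') Z u = nab D V Z u - nab D V' Z u.
Proof. by move=> vV vV' pZ up; apply: (conn_vecB HD) => //;
  [exact: vV.1|exact: vV'.1]. Qed.

Lemma nab_congr V V' Z Z' u : vector_field (SM M) V -> pi_field Z ->
  (forall p, pts (SM M) p -> V p = V' p) ->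
    (forall p, pts (SM M) p -> Z p = Z' p) ->
  pts (SM M) u -> nab D V Z u = nab D V' Z' u.
Proof.
move=> vV pZ VV' ZZ' up; rewrite /nab -VV' //.
by apply: (conn_local HD) => //; exact: vV.1.
Qed.

Lemma torsionC V W u : vector_field (SM M) V -> vector_field (SM M) W ->
  pts (SM M) u ->
  torsion D V W u = - torsion D W V u.
Proof.
move=> vV vW up.
have bt := bracket_tangent HS vW vV up.
have E : rhof (bracket (SM M) V W) u = - rhof (bracket (SM M) W V) u.
  by rewrite /rhof bracketC rhoN.
rewrite -[LHS]/(nab D V (rhof W) u - nab D W (rhof V) u - rhof
  (bracket (SM M) V W) u) E.
have key (a b c0 : tvec (charts M)) : a - b - - c0 = - (b - a - c0) by
  tvec_ring.
exact: key.
Qed.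

Lemma torsionBl V V' W u : vector_field (SM M) V -> vector_field (SM M) V' ->
  vector_field (SM M) W -> pts (SM M) u ->
  torsion D (V - V') W u = torsion D V W u - torsion D V' W u.
Proof.
move=> vV vV' vW up.
have bt := bracket_tangent HS vV vW up; have bt' :=
  bracket_tangent HS vV' vW up.
have E1 := nab_fieldB vV vV' (pi_field_rho vW) up.
have E2 : nab D W (rhof (V - V')) u = nab D W (rhof V) u - nab D W (rhof V') u.
  rewrite -(nab_sectB HD vW (pi_field_rho vV) (pi_field_rho vV') up).
  apply: nab_congr => //; first exact: pi_field_rho (vector_fieldB HS vV vV').
  by move=> p pp; apply: rhoB => //; [exact: vV.1|exact: vV'.1].
have E3 : rhof (bracket (SM M) (V - V') W) u
    = rhof (bracket (SM M) V W) u - rhof (bracket (SM M) V' W) u.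
  by rewrite /rhof (bracketBl vV vV' vW up) rhoB.
rewrite -[LHS]/(nab D (V - V') (rhof W) u - nab D W (rhof (V - V')) u
  - rhof (bracket (SM M) (V - V') W) u) E1 E2 E3.
have key (a b c0 d e f : tvec (charts M)) :
    (a - b) - (c0 - d) - (e - f) = (a - c0 - e) - (b - d - f) by tvec_ring.
exact: key.
Qed.

Lemma torsionBr V W W' u : vector_field (SM M) V -> vector_field (SM M) W ->
  vector_field (SM M) W' -> pts (SM M) u ->
  torsion D V (W - W') u = torsion D V W u - torsion D V W' u.
Proof.
move=> vV vW vW' up; rewrite (torsionC vV (vector_fieldB HS vW vW') up)
  (torsionBl vW vW' vV up).
by rewrite (torsionC vV vW up) (torsionC vV vW' up) opprB opprK addrC.
Qed.

Lemma torsion_congr V V' W W' u : vector_field (SM M) V ->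
  vector_field (SM M) W ->
  (forall p, pts (SM M) p -> V p = V' p) ->
    (forall p, pts (SM M) p -> W p = W' p) ->
  pts (SM M) u -> torsion D V W u = torsion D V' W' u.
Proof.
move=> vV vW VV' WW' up.
have E1 : nab D V (rhof W) u = nab D V' (rhof W') u.
  by apply: nab_congr => //; [exact: pi_field_rho|move=> p pp;
    rewrite /rhof WW'].
have E2 : nab D W (rhof V) u = nab D W' (rhof V') u.
  by apply: nab_congr => //; [exact: pi_field_rho|move=> p pp;
    rewrite /rhof VV'].
have E3 : rhof (bracket (SM M) V W) u = rhof (bracket (SM M) V' W') u.
  by rewrite /rhof (bracket_congr HS vV vW VV' WW' up).
by rewrite -[LHS]/(nab D V (rhof W) u - nab D W (rhof V) u - rhof
  (bracket (SM M) V W) u) E1 E2 E3.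
Qed.

Lemma torsion_gamma X Y u : pi_field X -> pi_field Y -> pts (SM M) u ->
  torsion D (gammaf X) (gammaf Y) u = 0.
Proof.
move=> pX pY up; have vX := vector_field_gamma pX; have vY :=
  vector_field_gamma pY.
have E1 : nab D (gammaf X) (rhof (gammaf Y)) u = 0.
  apply: (conn_vanish HD) => //; [exact: pi_field_rho|by move=> p;
    exact: rhof_gammaf|exact: vX.1].
have E2 : nab D (gammaf Y) (rhof (gammaf X)) u = 0.
  apply: (conn_vanish HD) => //; [exact: pi_field_rho|by move=> p;
    exact: rhof_gammaf|exact: vY.1].
rewrite -[LHS]/(nab D (gammaf X) (rhof (gammaf Y)) u - nab D (gammaf Y)
  (rhof (gammaf X)) u
  - rhof (bracket (SM M) (gammaf X) (gammaf Y)) u) E1 E2 rho_bracket_gamma //.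
by rewrite !subr0.
Qed.

Lemma curv_at V W Z u : curv D V W Z u
  = - nab D V (nab D W Z) u + nab D W (nab D V Z) u + nab D (bracket (SM M) V W)
    Z u.
Proof. by []. Qed.

Lemma conn_vecN (w : tvec (SM M)) Z u : pi_field Z -> pts (SM M) u ->
  tangent (SM M) u w ->
  D Z u (- w) = - D Z u w.
Proof.
move=> pZ up wt; have := conn_vecB HD pZ up (tangent0 (A := SM M) (x := u)) wt.
by rewrite !sub0r (conn_vec0 HD) // sub0r.
Qed.

Lemma curvC V W Z u : vector_field (SM M) V -> vector_field (SM M) W ->
  pi_field Z ->
  pts (SM M) u -> curv D V W Z u = - curv D W V Z u.
Proof.
move=> vV vW pZ up; rewrite !curv_at.
have -> : nab D (bracket (SM M) V W) Z u = - nab D (bracket (SM M) W V) Z u.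
  by rewrite /nab bracketC conn_vecN //; exact: bracket_tangent.
have key (a b c0 : tvec (charts M)) : - a + b + - c0 = - (- b + a + c0) by
  tvec_ring.
exact: key.
Qed.

Lemma curvBl V V' W Z u : vector_field (SM M) V -> vector_field (SM M) V' ->
  vector_field (SM M) W -> pi_field Z -> pts (SM M) u ->
  curv D (V - V') W Z u = curv D V W Z u - curv D V' W Z u.
Proof.
move=> vV vV' vW pZ up; rewrite !curv_at.
have pWZ := pi_field_nab HD vW pZ; have pVZ := pi_field_nab HD vV pZ;
  have pV'Z := pi_field_nab HD vV' pZ.
have E1 := nab_fieldB vV vV' pWZ up.
have E2 : nab D W (nab D (V - V') Z) u = nab D W (nab D V Z) u - nab D W
  (nab D V' Z) u.
  rewrite -(nab_sectB HD vW pVZ pV'Z up).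
  have p1 : pi_field (nab D (V - V') Z) :=
    pi_field_nab HD (vector_fieldB HS vV vV') pZ.
  apply: nab_congr => //.
  by move=> p pp; exact: nab_fieldB.
have E3 : nab D (bracket (SM M) (V - V') W) Z u
    = nab D (bracket (SM M) V W) Z u - nab D (bracket (SM M) V' W) Z u.
  have bt := bracket_tangent HS vV vW up; have bt' :=
    bracket_tangent HS vV' vW up.
  exact: etrans (congr1 (D Z u) (bracketBl vV vV' vW up))
    (conn_vecB HD pZ up bt bt').
have key (a b c0 d e f x y z : tvec (charts M)) : x = a - b -> y = c0 - d ->
  z = e - f ->
    - x + y + z = (- a + c0 + e) - (- b + d + f).
  by move=> -> -> ->; tvec_ring.
exact: key E1 E2 E3.
Qed.

Lemma curvBr V W W' Z u : vector_field (SM M) V -> vector_field (SM M) W ->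
  vector_field (SM M) W' -> pi_field Z -> pts (SM M) u ->
  curv D V (W - W') Z u = curv D V W Z u - curv D V W' Z u.
Proof.
move=> vV vW vW' pZ up.
rewrite (curvC vV (vector_fieldB HS vW vW') pZ up) (curvBl vW vW' vV pZ up).
by rewrite (curvC vV vW pZ up) (curvC vV vW' pZ up) opprB opprK addrC.
Qed.

Lemma curv_congr V V' W W' Z u : vector_field (SM M) V ->
  vector_field (SM M) W ->
  pi_field Z ->
  (forall p, pts (SM M) p -> V p = V' p) ->
    (forall p, pts (SM M) p -> W p = W' p) ->
  pts (SM M) u -> curv D V W Z u = curv D V' W' Z u.
Proof.
move=> vV vW pZ VV' WW' up; rewrite !curv_at.
have E1 : nab D V (nab D W Z) u = nab D V' (nab D W' Z) u.
  by apply: nab_congr => //; [exact: pi_field_nab|move=> p pp;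
    exact: nab_congr].
have E2 : nab D W (nab D V Z) u = nab D W' (nab D V' Z) u.
  by apply: nab_congr => //; [exact: pi_field_nab|move=> p pp;
    exact: nab_congr].
have E3 : nab D (bracket (SM M) V W) Z u = nab D (bracket (SM M) V' W') Z u.
  by rewrite /nab (bracket_congr HS vV vW VV' WW' up).
by rewrite E1 E2 E3.
Qed.

End Bilinear.

(** * The change of the curvature *)

Section ConformalCurvature.
Context {R : realType} {n : nat} {M : manifold R n}.
Implicit Types (u : bundle_pt M) (X Y Z : pfield M) (V W : field M).
Let HM := @charts_smooth R n M.
Let HS := @slit_smooth R n M.
Variables (L L' : bundle_pt M -> R) (sigma : M -> R) (D D' : connection M).
Hypotheses (hL : finsler L) (hL' : finsler L') (hconf : conformal sigma L L').
Hypotheses (hD : cartan_connection L D) (hD' : cartan_connection L' D').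
Let HD := cartan_linear hD.
Let HD' := cartan_linear hD'.
Let HR := cartan_regular hD.
Let HR' := cartan_regular hD'.
Notation B := (Bdiff D D').
Notation N := (Ndiff D D').

Lemma Bdiff_at X Z u : B X Z u = D' Z u (beta D u (X u)) - D Z u
  (beta D u (X u)).
Proof. by []. Qed.

Lemma Bdiff_congr X X' Z Z' u : pi_field X -> pi_field Z -> X u = X' u ->
  (forall p, pts (SM M) p -> Z p = Z' p) -> pts (SM M) u -> B X Z u = B X' Z' u.
Proof.
move=> pX pZ XX' ZZ' up; rewrite !Bdiff_at -XX'.
have tb := (vector_field_beta HD HR pX).1 u up.
exact: (congr2 (fun p q => p - q) (conn_local HD' pZ ZZ' up tb)
  (conn_local HD pZ ZZ' up tb)).
Qed.

Lemma Bdiff0l X Z u : pi_field Z -> X u = 0 -> pts (SM M) u -> B X Z u = 0.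
Proof.
move=> pZ X0 up; rewrite Bdiff_at X0 (beta0 HD HR) //.
have key (p q : tvec (charts M)) : p = 0 -> q = 0 -> p - q = 0 by move=> -> ->;
  rewrite subrr.
exact: key (conn_vec0 HD' pZ up) (conn_vec0 HD pZ up).
Qed.

Lemma Bdiff0r X Z u : pi_field X -> pi_field Z ->
  (forall p, pts (SM M) p -> Z p = 0) ->
  pts (SM M) u -> B X Z u = 0.
Proof.
move=> pX pZ Z0 up; have tb := (vector_field_beta HD HR pX).1 u up;
  rewrite Bdiff_at.
have key (p q : tvec (charts M)) : p = 0 -> q = 0 -> p - q = 0 by move=> -> ->;
  rewrite subrr.
exact: key (conn_vanish HD' pZ Z0 up tb) (conn_vanish HD pZ Z0 up tb).
Qed.

Lemma BdiffBl X X' Z u : pi_field X -> pi_field X' -> pi_field Z ->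
  pts (SM M) u ->
  B (X - X') Z u = B X Z u - B X' Z u.
Proof.
move=> pX pX' pZ up; rewrite !Bdiff_at.
have tb := (vector_field_beta HD HR pX).1 u up; have tb' :=
  (vector_field_beta HD HR pX').1 u up.
have bB := betaB HD HR up (pX.1 u up) (pX'.1 u up).
have E1 := etrans (congr1 (D' Z u) bB) (conn_vecB HD' pZ up tb tb').
have E2 := etrans (congr1 (D Z u) bB) (conn_vecB HD pZ up tb tb').
have key (x y a b c0 d : tvec (charts M)) : x = a - b -> y = c0 - d ->
   x - y = (a - c0) - (b - d) by move=> -> ->; tvec_ring.
exact: key E1 E2.
Qed.

Lemma BdiffNl X Z u : pi_field X -> pi_field Z -> pts (SM M) u ->
  B (- X) Z u = - B X Z u.
Proof.
move=> pX pZ up; have := BdiffBl (pi_field0 (M := M)) pX pZ up.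
by rewrite !sub0r (Bdiff0l (X := 0)) // sub0r.
Qed.

Lemma BdiffBr X Z Z' u : pi_field X -> pi_field Z -> pi_field Z' ->
  pts (SM M) u ->
  B X (Z - Z') u = B X Z u - B X Z' u.
Proof.
move=> pX pZ pZ' up; rewrite !Bdiff_at.
have tb := (vector_field_beta HD HR pX).1 u up.
have E1 := conn_sectB HD' pZ pZ' up tb.
have E2 := conn_sectB HD pZ pZ' up tb.
have key (x y a b c0 d : tvec (charts M)) : x = a - b -> y = c0 - d ->
   x - y = (a - c0) - (b - d) by move=> -> ->; tvec_ring.
exact: key E1 E2.
Qed.

Lemma nabB_at V Y Z u : nabB D D' V Y Z u
  = nab D V (B Y Z) u - B (nab D V Y) Z u - B Y (nab D V Z) u.
Proof. by []. Qed.

Lemma nabB0 V Y Z u : vector_field (SM M) V -> pi_field Y -> pi_field Z ->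
  (forall p, pts (SM M) p -> Y p = 0) -> pts (SM M) u -> nabB D D' V Y Z u = 0.
Proof.
move=> vV pY pZ Y0 up; rewrite nabB_at.
have E1 : nab D V (B Y Z) u = 0.
  apply: (conn_vanish HD) => //; [exact: (pi_field_Bdiff hD hD')| |exact: vV.1].
  by move=> p pp; apply: Bdiff0l => //; exact: Y0.
have E2 : B (nab D V Y) Z u = 0.
  by apply: Bdiff0l => //; apply: (conn_vanish HD) => //; exact: vV.1.
have E3 : B Y (nab D V Z) u = 0.
  by apply: Bdiff0l => //; [exact: (pi_field_nab HD)|exact: Y0].
by rewrite E1 E2 E3 !subr0.
Qed.

Lemma nabB_congr V V' Y Y' Z u : vector_field (SM M) V -> pi_field Y ->
  pi_field Z ->
  (forall p, pts (SM M) p -> V p = V' p) ->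
    (forall p, pts (SM M) p -> Y p = Y' p) ->
  pts (SM M) u -> nabB D D' V Y Z u = nabB D D' V' Y' Z u.
Proof.
move=> vV pY pZ VV' YY' up; rewrite !nabB_at.
have E1 : nab D V (B Y Z) u = nab D V' (B Y' Z) u.
  apply: (nab_congr HD) => //; first exact: (pi_field_Bdiff hD hD').
  by move=> p pp; apply: Bdiff_congr => //; exact: YY'.
have E2 : B (nab D V Y) Z u = B (nab D V' Y') Z u.
  by apply: Bdiff_congr => //; [exact: (pi_field_nab HD)|exact: (nab_congr HD)].
have E3 : B Y (nab D V Z) u = B Y' (nab D V' Z) u.
  apply: Bdiff_congr => //; [exact: (pi_field_nab HD)|exact: YY'|].
  by move=> p pp; exact: (nab_congr HD).
by rewrite E1 E2 E3.
Qed.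

Lemma nabB_fieldB V V' Y Z u : vector_field (SM M) V ->
  vector_field (SM M) V' ->
  pi_field Y -> pi_field Z -> pts (SM M) u ->
  nabB D D' (V - V') Y Z u = nabB D D' V Y Z u - nabB D D' V' Y Z u.
Proof.
move=> vV vV' pY pZ up; rewrite !nabB_at.
have pVY := pi_field_nab HD vV pY; have pV'Y := pi_field_nab HD vV' pY.
have pVZ := pi_field_nab HD vV pZ; have pV'Z := pi_field_nab HD vV' pZ.
have pBYZ := pi_field_Bdiff hD hD' pY pZ.
have E1 := nab_fieldB HD vV vV' pBYZ up.
have E2 : B (nab D (V - V') Y) Z u = B (nab D V Y) Z u - B (nab D V' Y) Z u.
  apply: etrans _ (BdiffBl pVY pV'Y pZ up).
  apply: Bdiff_congr => //; last exact: (nab_fieldB HD).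
  exact: (pi_field_nab HD (vector_fieldB HS vV vV') pY).
have E3 : B Y (nab D (V - V') Z) u = B Y (nab D V Z) u - B Y (nab D V' Z) u.
  apply: etrans _ (BdiffBr pY pVZ pV'Z up).
  apply: Bdiff_congr => //; last by move=> p pp; exact: (nab_fieldB HD).
  exact: (pi_field_nab HD (vector_fieldB HS vV vV') pZ).
have key (a b c0 d e f x y z : tvec (charts M)) : x = a - b -> y = c0 - d ->
  z = e - f ->
    x - y - z = (a - c0 - e) - (b - d - f).
  by move=> -> -> ->; tvec_ring.
exact: key E1 E2 E3.
Qed.

(** Both derivatives are replaced according to [nab_Bdiff]. *)
Lemma nab_nab V W Z u : vector_field (SM M) V -> vector_field (SM M) W ->
  pi_field Z ->
  pts (SM M) u ->
  nab D' V (nab D' W Z) u = nab D V (nab D W Z) u + nab D V (B (rhof W) Z) u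
    + B (rhof V) (nab D W Z) u + B (rhof V) (B (rhof W) Z) u.
Proof.
move=> vV vW pZ up.
have pr := pi_field_rho vW; have pB := pi_field_Bdiff hD hD' pr pZ.
have pV := pi_field_rho vV.
have pWZ := pi_field_nab HD vW pZ; have pW'Z := pi_field_nab HD' vW pZ.
have S p : pts (SM M) p -> nab D' W Z p = (nab D W Z + B (rhof W) Z) p.
  by move=> pp; exact: (nab_Bdiff hL hL' hconf hD hD').
have E0 := nab_Bdiff hL hL' hconf hD hD' vV pW'Z up.
have E1 : nab D V (nab D' W Z) u = nab D V (nab D W Z) u + nab D V
  (B (rhof W) Z) u.
  apply: etrans (nab_congr HD vV pW'Z (fun p _ => erefl) S up) _.
  exact: (conn_add HD pWZ pB up (vV.1 u up)).
have E2 : B (rhof V) (nab D' W Z) u = B (rhof V) (nab D W Z) u + B (rhof V)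
  (B (rhof W) Z) u.
  have := BdiffBr pV pW'Z pWZ up.
  have -> : B (rhof V) (nab D' W Z - nab D W Z) u = B (rhof V) (B (rhof W) Z) u.
    apply: Bdiff_congr => //; first exact: pi_fieldB.
    by move=> p pp; rewrite -[LHS]/(nab D' W Z p - nab D W Z p) S // [LHS]addrC
      addKr.
  by move=> ->; rewrite addrC subrK.
have key (x y z a b c0 d : tvec (charts M)) : x = y + z -> y = a + b ->
  z = c0 + d ->
   x = a + b + c0 + d by move=> -> -> ->; tvec_ring.
exact: key E0 E1 E2.
Qed.

(** In the alternation of [nab_nab] the terms with B (rho V) (nab D W Z) are
    those that complete D_V (B (rho W) Z) to the covariant derivative of B, up
    to B (nab D V (rho W)) Z; with the bracket the latter give the torsion. *)
Lemma curv_conformal V W Z u : vector_field (SM M) V -> vector_field (SM M) W ->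
  pi_field Z -> pts (SM M) u ->
  curv D' V W Z u = curv D V W Z u -
    (nabB D D' V (rhof W) Z u - nabB D D' W (rhof V) Z u
    + (B (rhof V) (B (rhof W) Z) u - B (rhof W) (B (rhof V) Z) u)
    + B (torsion D V W) Z u).
Proof.
move=> vV vW pZ up; rewrite !curv_at !nabB_at.
have vb := vector_field_bracket HS vV vW; have pV := pi_field_rho vV; have pW :=
  pi_field_rho vW.
have E1 := nab_nab vV vW pZ up; have E2 := nab_nab vW vV pZ up.
have E3 := nab_Bdiff hL hL' hconf hD hD' vb pZ up.
have E4 : B (torsion D V W) Z u = B (nab D V (rhof W)) Z u - B
  (nab D W (rhof V)) Z u
   - B (rhof (bracket (SM M) V W)) Z u.
  have p1 := pi_field_nab HD vV pW; have p2 := pi_field_nab HD vW pV; have p3 :=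
    pi_field_rho vb.
  apply: etrans (BdiffBl (pi_fieldB p1 p2) p3 pZ up) _.
  exact: (congr1 (fun t => t - _) (BdiffBl p1 p2 pZ up)).
have key (x y z t a a' e b b' c0 c' d d' f f' g : tvec (charts M)) :
    x = a + b + c0 + d -> y = a' + b' + c' + d' -> z = e + g ->
      t = f - f' - g ->
    - x + y + z = - a + a' + e - (b - f - c' - (b' - f' - c0) + (d - d') + t).
  by move=> -> -> -> ->; tvec_ring.
exact: key E1 E2 E3 E4.
Qed.

(** As the torsion is alternating, half of its alternation is the torsion. *)
Lemma curv_conformal_alt V W Z u : vector_field (SM M) V ->
  vector_field (SM M) W ->
  pi_field Z -> pts (SM M) u ->
  curv D' V W Z u = (curv D V W Z
    - alt (fun V W => nabB D D' V (rhof W) Z + B (rhof V) (B (rhof W) Z)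
                      + 2^-1 *: B (torsion D V W) Z) V W) u.
Proof.
move=> vV vW pZ up; have E := curv_conformal vV vW pZ up.
have pT := pi_field_torsion HD vV vW; have pT' := pi_field_torsion HD vW vV.
have T : B (torsion D W V) Z u = - B (torsion D V W) Z u.
  apply: etrans _ (BdiffNl pT pZ up).
  apply: Bdiff_congr => //; rewrite -[RHS]/(- torsion D V W u).
  exact: (torsionC D vW vV up).
have key (x k a b c0 d t t' : tvec (charts M)) : x = k - (a - b + (c0 - d) + t)
  -> t' = - t ->
    x = k - (a + c0 + 2^-1 *: t - (b + d + 2^-1 *: t')).
  move=> -> ->; apply/funext => c; apply/rowP => i; rewrite ?fctE ?mxE; lra.
exact: key E T.
Qed.

(** All the correction terms contain rho of a vertical field or the torsion of
    two vertical fields. *)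
Lemma Scurv_conformal X Y Z u : pi_field X -> pi_field Y -> pi_field Z ->
  pts (SM M) u ->
  Scurv D' X Y Z u = Scurv D X Y Z u.
Proof.
move=> pX pY pZ up; have vX := vector_field_gamma pX; have vY :=
  vector_field_gamma pY.
have rX p : pts (SM M) p -> rhof (gammaf X) p = 0 by exact: rhof_gammaf.
have rY p : pts (SM M) p -> rhof (gammaf Y) p = 0 by exact: rhof_gammaf.
have pr := pi_field_rho vX; have pr' := pi_field_rho vY.
have E0 := curv_conformal vX vY pZ up.
have E1 := nabB0 vX pr' pZ rY up; have E2 := nabB0 vY pr pZ rX up.
have E3 := Bdiff0l (pi_field_Bdiff hD hD' pr' pZ) (rX u up) up.
have E4 := Bdiff0l (pi_field_Bdiff hD hD' pr pZ) (rY u up) up.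
have E5 := Bdiff0l pZ (torsion_gamma HD pX pY up) up.
have key (x k a a' b b' t : tvec (charts M)) : x = k - (a - a' + (b - b') + t)
  ->
    a = 0 -> a' = 0 -> b = 0 -> b' = 0 -> t = 0 -> x = k.
  by move=> -> -> -> -> -> ->; rewrite !subrr !addr0 subr0.
exact: key E0 E1 E2 E3 E4 E5.
Qed.

(** Since rho (gamma Y) = 0, the correction terms that remain are the derivative
    of B along gamma Y and the mixed torsion; the term with S comes from beta' X
    = beta X - gamma (N X). *)
Lemma Pcurv_conformal X Y Z u : pi_field X -> pi_field Y -> pi_field Z ->
  pts (SM M) u ->
  Pcurv D' X Y Z u = (Pcurv D X Y Z - Vterm D D' X Y Z) u.
Proof.
move=> pX pY pZ up.
have vY := vector_field_gamma pY; have vb := vector_field_beta HD HR pX;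
  have vb' := vector_field_beta HD' HR' pX.
have pN := pi_field_Ndiff hD hD' pX; have vN := vector_field_gamma pN.
have bE p : pts (SM M) p -> betaf D' X p = (betaf D X - gammaf (N X)) p.
  by move=> pp; exact: (beta_conformal hL' hD hD').
have rY p : pts (SM M) p -> rhof (gammaf Y) p = 0 by exact: rhof_gammaf.
have rb p : pts (SM M) p -> rhof (betaf D' X) p = X p by exact:
  (rhof_betaf HR').
have pr := pi_field_rho vb'; have prY := pi_field_rho vY.
have E0 := curv_conformal vb' vY pZ up.
have E1 : curv D (betaf D' X) (gammaf Y) Z u = Pcurv D X Y Z u - Scurv D (N X) Y
  Z u.
  exact: etrans (curv_congr HD vb' vY pZ bE (fun p _ => erefl) up)
    (curvBl HD vb vN vY pZ up).
have E2 := nabB0 vb' prY pZ rY up.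
have E3 : nabB D D' (gammaf Y) (rhof (betaf D' X)) Z u = nabB D D' (gammaf Y) X
  Z u.
  exact: nabB_congr.
have E4 : B (rhof (betaf D' X)) (B (rhof (gammaf Y)) Z) u = 0.
  apply: Bdiff0r => //; first exact: (pi_field_Bdiff hD hD').
  by move=> p pp; apply: Bdiff0l => //; exact: rY.
have E5 : B (rhof (gammaf Y)) (B (rhof (betaf D' X)) Z) u = 0.
  by apply: Bdiff0l => //; [exact: (pi_field_Bdiff hD hD')|exact: rY].
have E6 : B (torsion D (betaf D' X) (gammaf Y)) Z u = - B (Ttor D Y X) Z u.
  have pT := pi_field_Ttor hD pY pX.
  have pT' : pi_field (torsion D (betaf D' X) (gammaf Y)).
    exact: (pi_field_torsion HD).
  apply: etrans _ (BdiffNl pT pZ up).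
  apply: (Bdiff_congr pT' pZ _ (fun p _ => erefl) up).
  apply: etrans (torsion_congr HD vb' vY bE (fun p _ => erefl) up) _.
  apply: etrans (torsionBl HD vb vN vY up) _.
  rewrite (torsion_gamma HD pN pY up) subr0.
  rewrite -[RHS]/(- Ttor D Y X u).
  exact: (torsionC D vb vY up).
have key (x k p s a a' b b' t t' v : tvec (charts M)) :
    x = k - (a - a' + (b - b') + t) -> k = p - s -> a = 0 -> a' = v -> b = 0 ->
      b' = 0 ->
    t = - t' -> x = p - (s - v - t').
  by move=> -> -> -> -> -> -> ->; tvec_ring.
exact: key E0 E1 E2 E3 E4 E5 E6.
Qed.

(** The curvature, the derivative of B and the torsion are expanded along beta'
    = beta - gamma N; the horizontal torsion vanishes by the axiom on Q. *)
Lemma Rcurv_conformal X Y Z u : pi_field X -> pi_field Y -> pi_field Z ->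
  pts (SM M) u ->
  Rcurv D' X Y Z u = (Rcurv D X Y Z + Hterm D D' X Y Z) u.
Proof.
move=> pX pY pZ up.
have vb Y' : pi_field Y' -> vector_field (SM M) (betaf D Y') by exact:
  (vector_field_beta HD HR).
have vb' Y' : pi_field Y' -> vector_field (SM M) (betaf D' Y') by exact:
  (vector_field_beta HD' HR').
have pN Y' : pi_field Y' -> pi_field (N Y') by exact: (pi_field_Ndiff hD hD').
have vN Y' (pY' : pi_field Y') := vector_field_gamma (pN Y' pY').
have bE Y' : pi_field Y' -> forall p, pts (SM M) p ->
    betaf D' Y' p = (betaf D Y' - gammaf (N Y')) p.
  by move=> pY' p pp; exact: (beta_conformal hL' hD hD').
have rb Y' : pi_field Y' -> forall p, pts (SM M) p ->
  rhof (betaf D' Y') p = Y' p.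
  by move=> pY' p pp; exact: (rhof_betaf HR' pY' pp).
have vd Y' (pY' : pi_field Y') := vector_fieldB HS (vb Y' pY') (vN Y' pY').
have E0 := curv_conformal (vb' X pX) (vb' Y pY) pZ up.
have E1 : curv D (betaf D' X) (betaf D' Y) Z u
    = Rcurv D X Y Z u - Pcurv D X (N Y) Z u + Pcurv D Y (N X) Z u + Scurv D
      (N X) (N Y) Z u.
  have F0 := curv_congr HD (vb' X pX) (vb' Y pY) pZ (bE X pX) (bE Y pY) up.
  have F1 := curvBl HD (vb X pX) (vN X pX) (vd Y pY) pZ up.
  have F2 := curvBr HD (vb X pX) (vb Y pY) (vN Y pY) pZ up.
  have F3 := curvBr HD (vN X pX) (vb Y pY) (vN Y pY) pZ up.
  have F4 := curvC HD (vN X pX) (vb Y pY) pZ up.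
  have key (x y a b r p q s q' : tvec (charts M)) : x = y -> y = a - b ->
    a = r - p -> b = q - s ->
      q = - q' -> x = r - p + q' + s.
    by move=> -> -> -> -> ->; tvec_ring.
  exact: key F0 F1 F2 F3 F4.
have E2 Y1 Y2 : pi_field Y1 -> pi_field Y2 ->
    nabB D D' (betaf D' Y1) (rhof (betaf D' Y2)) Z u
    = nabB D D' (betaf D Y1) Y2 Z u - nabB D D' (Lcal D D' (betaf D Y1)) Y2 Z u.
  move=> p1 p2.
  have F0 := nabB_congr (vb' _ p1) (pi_field_rho (vb' _ p2)) pZ (bE _ p1)
    (rb _ p2) up.
  have F1 := nabB_fieldB (vb _ p1) (vN _ p1) p2 pZ up.
  have LE p : pts (SM M) p -> gammaf (N Y1) p = Lcal D D' (betaf D Y1) p.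
    move=> pp; rewrite /Lcal /gammaf; congr (gamma p _).
    apply: Bdiff_congr => //; first exact: pi_field_eta.
    exact: esym (rhof_betaf HR p1 pp).
  have F2 := nabB_congr (vN _ p1) p2 pZ LE (fun p _ => erefl) up.
  exact: etrans F0 (etrans F1 (congr1 (fun t => _ - t) F2)).
have E3 Y1 Y2 : pi_field Y1 -> pi_field Y2 ->
    B (rhof (betaf D' Y1)) (B (rhof (betaf D' Y2)) Z) u = B Y1 (B Y2 Z) u.
  move=> p1 p2; have r1 := pi_field_rho (vb' _ p1); have r2 :=
    pi_field_rho (vb' _ p2).
  apply: Bdiff_congr => //; [exact: (pi_field_Bdiff hD hD')|exact: rb|].
  by move=> p pp; apply: Bdiff_congr => //; exact: rb.
have E4 : B (torsion D (betaf D' X) (betaf D' Y)) Z u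
    = B (Ttor D (N Y) X) Z u - B (Ttor D (N X) Y) Z u.
  have pT1 := pi_field_Ttor hD (pN _ pY) pX; have pT2 :=
    pi_field_Ttor hD (pN _ pX) pY.
  have pT : pi_field (torsion D (betaf D' X) (betaf D' Y)).
    by apply: (pi_field_torsion HD); exact: vb'.
  apply: etrans _ (BdiffBl pT1 pT2 pZ up).
  apply: (Bdiff_congr pT pZ _ (fun p _ => erefl) up).
  have F0 := torsion_congr HD (vb' X pX) (vb' Y pY) (bE X pX) (bE Y pY) up.
  have F1 := torsionBl HD (vb X pX) (vN X pX) (vd Y pY) up.
  have F2 := torsionBr HD (vb X pX) (vb Y pY) (vN Y pY) up.
  have F3 := torsionBr HD (vN X pX) (vb Y pY) (vN Y pY) up.
  have F4 := torsionC D (vb X pX) (vN Y pY) up.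
  have F5 := torsion_gamma HD (pN _ pX) (pN _ pY) up.
  have F6 := cartan_Q hD pX pY up.
  have key (x y a b q p t s p' : tvec (charts M)) : x = y -> y = a - b ->
    a = q - p -> b = t - s ->
      p = - p' -> s = 0 -> q = 0 -> x = p' - t.
    by move=> -> -> -> -> -> -> ->; tvec_ring.
  exact: key F0 F1 F2 F3 F4 F5 F6.
have key (x k r p q s a a' n1 m1 n2 m2 b b' c0 c' t t1 t2 : tvec (charts M)) :
    x = k - (a - a' + (b - b') + t) -> k = r - p + q + s ->
    a = n1 - m1 -> a' = n2 - m2 -> b = c0 -> b' = c' -> t = t2 - t1 ->
    x = r + (s - (p + n1 - m1 + c0 - t1 - (q + n2 - m2 + c' - t2))).
  by move=> -> -> -> -> -> -> ->; tvec_ring.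
exact: key E0 E1 (E2 _ _ pX pY) (E2 _ _ pY pX) (E3 _ _ pX pY) (E3 _ _ pY pX) E4.
Qed.

End ConformalCurvature.

Theorem theorem4p6 (R : realType) (n : nat) (M : manifold R n)
    (L L' : bundle_pt M -> R) (sigma : M -> R) (D D' : connection M)
    (hL : finsler L) (hL' : finsler L')
    (hsigma : smooth_fun (charts M) sigma) (hconf : conformal sigma L L')
    (hD : cartan_connection L D) (hD' : cartan_connection L' D') :
  [/\ (forall (X Y : field M) (Z : pfield M) (u : bundle_pt M),
        vector_field (SM M) X -> vector_field (SM M) Y ->
        pi_field Z -> pts (SM M) u ->
        curv D' X Y Z u
        = (curv D X Y Z
           - alt (fun X Y => nabB D D' X (rhof Y) Z
                             + Bdiff D D' (rhof X) (Bdiff D D' (rhof Y) Z)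
                             + 2^-1 *: Bdiff D D' (torsion D X Y) Z) X Y) u),
      (forall (X Y Z : pfield M) (u : bundle_pt M),
        pi_field X -> pi_field Y -> pi_field Z -> pts (SM M) u ->
        Scurv D' X Y Z u = Scurv D X Y Z u),
      (forall (X Y Z : pfield M) (u : bundle_pt M),
        pi_field X -> pi_field Y -> pi_field Z -> pts (SM M) u ->
        Pcurv D' X Y Z u = (Pcurv D X Y Z - Vterm D D' X Y Z) u) &
      (forall (X Y Z : pfield M) (u : bundle_pt M),
        pi_field X -> pi_field Y -> pi_field Z -> pts (SM M) u ->
        Rcurv D' X Y Z u = (Rcurv D X Y Z + Hterm D D' X Y Z) u)].
Proof.
split=> X Y Z u.
- exact: (curv_conformal_alt hL hL' hconf hD hD').
- exact: (Scurv_conformal hL hL' hconf hD hD').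
- exact: (Pcurv_conformal hL hL' hconf hD hD').
- exact: (Rcurv_conformal hL hL' hconf hD hD').
Qed.
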